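(* Suppose that $(\mathcal{X},f,\mu)$ is a measure preserving dynamical system which is hyperbolic recurrent, and let $\rho$ be the density of $\mu$. Then the following hold. (a) (Almost sure upper bounds.) Assume one of the following alternatives: (i) the density $\rho$ is strictly positive, and $(r_n)$ is a sequence satisfying $r_n>\frac{c\log\log n}{n}$, where $2c\,(\inf_{x\in\mathcal{X}}\rho(x))>1$; (ii) the density $\rho$ is uniformly Hölder continuous, and $(r_n)$ is a sequence satisfying $r_n>\frac{(\log n)^{\gamma}}{2n}$ with $\gamma>\gamma_0$, where $\gamma_0$ is such that $$\sum_{k\ge1}\int_{\mathcal{X}}\rho(x)e^{-\epsilon k^{\gamma_0}\rho(x)}\,dx<\infty\quad\text{for all }\epsilon>0 .$$ Then, in either case (i) or (ii), $$\mu\left(x\in\mathcal{X}:\ \min_{1\le k\le n}d(f^kx,x)<r_n\ \text{eventually}\right)=1 .$$ (b) (Almost sure lower bound.) Suppose that the sequence $(r_n)$ satisfies $\sum_{n=1}^{\infty}\int_{\mathcal{X}}\mu(B(x,r_n))\,d\mu(x)<\infty$. Then $$\mu\left(x\in\mathcal{X}:\ \min_{1\le k\le n}d(f^kx,x)>r_n\ \text{eventually}\right)=1 .$$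
   Context: Throughout, $\mathcal{X}\subset\mathbb{R}$ is an interval with metric $d(x,y)=|x-y|$, $f:\mathcal{X}\to\mathcal{X}$ is a measurable map, and $\mu$ is an ergodic $f$-invariant Borel probability measure which is absolutely continuous with respect to Lebesgue measure (an acip), with density $\rho$. $B(x,r)$ is the ball of centre $x$ and radius $r$. ''Eventually'' means for all sufficiently large $n$ (depending on $x$). Norms: $\|\varphi\|_1=\int|\varphi|\,d\mu$, and $\|\varphi\|_{\mathrm{BV}}=\mathrm{var}(\varphi)+\sup|\varphi|$, where $\mathrm{var}(\varphi)$ is the total variation of $\varphi$ on $\mathcal{X}$, i.e. the supremum of $\sum_{i=1}^m|\varphi(x_i)-\varphi(x_{i-1})|$ over finite sequences $x_0<x_1<\dots<x_m$ in $\mathcal{X}$. $\mathrm{BV}$ is the space of functions with $\|\varphi\|_{\mathrm{BV}}<\infty$. (A1) Exponential decay of correlations of $\mathrm{BV}$ against $L^1(\mu)$: there is a rate function $\Theta(j)=C_0e^{-c_0j}$ with $C_0,c_0>0$ such that for all $\varphi_1\in\mathrm{BV}$, $\varphi_2\in L^1(\mu)$ and all $j$, $$\left|\int\varphi_1\cdot\varphi_2\circ f^j\,d\mu-\int\varphi_1\,d\mu\int\varphi_2\,d\mu\right|\le\Theta(j)\|\varphi_1\|_{\mathrm{BV}}\|\varphi_2\|_1 .$$ (A2) With $E_j(r):=\{x\in\mathcal{X}: d(x,f^jx)\le r\}$: whenever $r_n\approx n^{-a}$ for some $a>0$ (meaning that the ratio $r_n/n^{-a}$ lies in $[c^{-1},c]$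 for a uniform constant $c>1$), there exist $\beta_0\in(0,1)$ and $C>0$ such that $\mu(E_j(r_n))\le C r_n^{\beta_0}$ for all $1\le j\le(\log n)^2$, with $C$ independent of $j$ (and $n$). The system $(\mathcal{X},f,\mu)$ is called hyperbolic recurrent if it satisfies (A1) and (A2) and $\mu$ is ergodic with invariant density $\rho\in\mathrm{BV}$.
   Formalization: In part (b) the sequence (r_n) is additionally assumed nonincreasing for n ≥ 1; for arbitrary sequences (b) fails, e.g. for the doubling map with r_n = n^{-1/2} when n is a fourth power and r_n = 2^{-n} otherwise. *)

(* Defs.v *)
From HB Require Import structures.
From mathcomp Require Export all_boot all_order all_algebra.
From mathcomp Require Export all_classical all_reals all_analysis.
Export Order.TTheory GRing.Theory Num.Theory numFieldNormedType.Exports.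

Set Implicit Arguments.
Unset Strict Implicit.
Unset Printing Implicit Defensive.

Local Open Scope classical_set_scope.
Local Open Scope ring_scope.

(* The phase space is an interval X : set R.  Maps and observables on X are
   total functions on R of which only the values on X are used, and measures
   on X are Borel measures on R carried by X. *)

(* In [variation a b phi s] the argument b is only the default of an [nth]:
   the value is the sum of the increments of phi along the sequence a :: s. *)
Definition var (R : realType) (X : set R) (phi : R -> R) : \bar R :=
  ereal_sup [set v : \bar R | exists (a : R) (s : seq R),
    [/\ path <%R a s, (forall x, x \in a :: s -> X x)
      & v = (variation a (last a s) phi s)%:E]].

Definition bv_norm (R : realType) (X : set R) (phi : R -> R) : \bar R :=
  (var X phi + ereal_sup [set `|phi x|%:E | x in X])%E.

Definition is_BV (R : realType) (X : set R) (phi : R -> R) : Prop :=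
  (bv_norm X phi < +oo)%E.

Definition l1_norm (R : realType) (X : set R)
    (mu : probability (measurableTypeR R) R) (phi : R -> R) : \bar R :=
  (\int[mu]_(x in X) `|phi x|%:E)%E.

Definition density_on (R : realType) (X : set R)
    (mu : probability (measurableTypeR R) R) (rho : R -> R) : Prop :=
  [/\ measurable_fun X rho, (forall x, X x -> 0 <= rho x)
    & forall A : set R, measurable A -> A `<=` X ->
        mu A = (\int[@lebesgue_measure R]_(x in A) (rho x)%:E)%E].

Definition invariant_on (R : realType) (X : set R) (f : R -> R)
    (mu : probability (measurableTypeR R) R) : Prop :=
  forall A : set R, measurable A -> A `<=` X -> mu (X `&` f @^-1` A) = mu A.

Definition ergodic_on (R : realType) (X : set R) (f : R -> R)
    (mu : probability (measurableTypeR R) R) : Prop :=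
  forall A : set R, measurable A -> A `<=` X -> X `&` f @^-1` A = A ->
    mu A = 0%E \/ mu A = 1%E.

(* Absolute continuity of mu is part of the existence of the density rho. *)
Definition acip_system (R : realType) (X : set R) (f : R -> R)
    (mu : probability (measurableTypeR R) R) (rho : R -> R) : Prop :=
  [/\ is_interval X, mu X = 1%E & density_on X mu rho] /\
  [/\ (forall x, X x -> X (f x)), measurable_fun X f,
      invariant_on X f mu & ergodic_on X f mu].

Definition exp_decay_correlations (R : realType) (X : set R) (f : R -> R)
    (mu : probability (measurableTypeR R) R) : Prop :=
  exists C0 c0 : R, [/\ 0 < C0, 0 < c0 &
    forall (phi1 phi2 : R -> R) (j : nat),
      is_BV X phi1 -> mu.-integrable X (EFin \o phi2) ->
      (`| \int[mu]_(x in X) (phi1 x * phi2 (iter j f x))%:E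
          - (\int[mu]_(x in X) (phi1 x)%:E) * (\int[mu]_(x in X) (phi2 x)%:E) |
       <= (C0 * expR (- (c0 * j%:R)))%:E * bv_norm X phi1
            * l1_norm X mu phi2)%E].

Definition E_set (R : realType) (X : set R) (f : R -> R) (j : nat) (r : R)
  : set R := [set x | X x /\ `|x - iter j f x| <= r].

(* Sequences are indexed by n >= 1; the value at n = 0 is never used. *)
Definition comparable_to_power (R : realType) (r : nat -> R) (a : R) : Prop :=
  exists2 c : R, 1 < c &
    forall n : nat, (1 <= n)%N -> c^-1 <= r n / (n%:R `^ (- a)) <= c.

Definition short_return_bound (R : realType) (X : set R) (f : R -> R)
    (mu : probability (measurableTypeR R) R) : Prop :=
  forall (a : R) (r : nat -> R), 0 < a -> comparable_to_power r a ->
  exists beta0 C : R, [/\ 0 < beta0 < 1, 0 < C &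
    forall n j : nat, (1 <= n)%N -> (1 <= j)%N -> j%:R <= (ln n%:R : R) ^+ 2 ->
      (mu (E_set X f j (r n)) <= (C * (r n `^ beta0))%:E)%E].

Definition hyperbolic_recurrent (R : realType) (X : set R) (f : R -> R)
    (mu : probability (measurableTypeR R) R) (rho : R -> R) : Prop :=
  [/\ acip_system X f mu rho, exp_decay_correlations X f mu,
      short_return_bound X f mu & is_BV X rho].

Definition holder_on (R : realType) (X : set R) (phi : R -> R) : Prop :=
  exists C alpha : R, [/\ 0 < C, 0 < alpha <= 1 &
    forall x y, X x -> X y -> `|phi x - phi y| <= C * (`|x - y| `^ alpha)].

(* The default value of the iterated minimum is its k = 1 term, so for n >= 1
   this is exactly the minimum over 1 <= k <= n. *)
Definition min_return (R : realType) (f : R -> R) (n : nat) (x : R) : R :=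
  \big[Num.min/`|f x - x|]_(1 <= k < n.+1) `|iter k f x - x|.

(* Main.v *)
From HB Require Import structures.
From mathcomp Require Import ring lra zify measurable_realfun.
Require Import Defs.

Set Implicit Arguments.
Unset Strict Implicit.
Unset Printing Implicit Defensive.

Local Open Scope classical_set_scope.
Local Open Scope ring_scope.

(** Both parts rest on the Borel-Cantelli lemma.  Decorrelation of functions of
    bounded variation against integrable functions applies to the indicators of
    an interval B and of an arbitrary measurable set A: up to an error of order
    expR (- c0 j) P(A), the event that x is in B and f^j x is in A has
    probability P(B) P(A).  To treat the event that f^j x is close to x itself,
    the line is cut into short cells, on each of which x is almost constant.

    Lower bound.  If x lies in a cell of length r and |x - f^k x| <= r, then
    f^k x lies in the cell or in one of its two neighbours.  Decorrelation and
    summation over the cells bound the probability of such a return by three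
    times the sum of the squared masses of the cells, plus an exponentially
    small term; that sum of squares is at most the integral of mu(B(x, r))
    ([pr_return_set_le]).  So the probabilities of a return at time k within
    r_k are summable, and late returns within r_n, which is at most r_k, are
    excluded.  The finitely many early ones are excluded since almost no point
    is periodic and r_n becomes smaller than any positive number
    ([eventually_lt_min_return]).

    Upper bound.  Fix a target interval B.  By invariance, the probability a_n
    of avoiding B for n steps decreases at step n by the probability of being in
    B and then avoiding B.  Replacing the latter by a product costs a waiting
    time t, hence an error D which is the sum over j < t of the probabilities of
    being in B at times 0 and j.  This gives a one-step recursion
      a_(n+1) <= (1 - P(B) + Theta t) a_n + D
    and an exponential bound for a_n ([avoid_exp]).  Now let x start in a cell of
    length h = r / (m+1), and let B consist of this cell and its m neighbours on
    either side.  All points of B are within r of x, and the length (2m+1) h of B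
    is close to 2r when m is large.  Summed over the cells, the main terms are at
    most the integral of rho expR (- 2 n r rho), up to a factor close to 1 in the
    exponent.  The errors D add up to a constant times n r times the sum of the
    probabilities of the returns before time t; by the bound on short returns,
    this is a negative power of n up to logarithms ([pr_no_return_le]).

    It remains to take n of order expR (tau k) with a lag t proportional to k
    ([near_pr_no_return]).  If rho >= m0 > 0 and n r = c ln (ln n), the main term
    is a power of k whose exponent tends to - 2 c m0 as tau tends to 0 and m to
    infinity, so it is summable when 2 c m0 > 1 ([upper_of_pos_density]).  If rho
    is Holder continuous and n r = (ln n)^gamma / 2, the main term is dominated by
    the k-th term of the series that is assumed to converge, because k^gamma
    exceeds any multiple of k^gamma0; the same series controls the mass of the
    points of low density, which may lie in too many cells
    ([upper_of_holder_density]).  As the minimum over k <= n decreases with n,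
    the times between two consecutive values of expR (tau k) follow
    ([eventually_min_return_lt]). *)

(** * Real-valued probabilities and summable sequences *)

(** Estimates are carried out in the field R; [prE] is the way back to the
    extended reals. *)
Definition pr d (T : measurableType d) (R : realType) (mu : probability T R)
  (A : set T) : R := fine (mu A).

(** For a nonnegative sequence this is summability. *)
Definition bounded_sums (R : realType) (u : nat -> R) : Prop :=
  exists S : R, forall n, \sum_(k < n) u k <= S.

Section bounded_sums.
Context {R : realType}.
Implicit Types u v : nat -> R.

Lemma bounded_sumsD u v :
  bounded_sums u -> bounded_sums v -> bounded_sums (fun k => u k + v k).
Proof.
move=> [S uS] [S' vS']; exists (S + S') => n.
by rewrite big_split/= lerD ?uS ?vS'.
Qed.

Lemma bounded_sumsZ c u : 0 <= c ->
  bounded_sums u -> bounded_sums (fun k => c * u k).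
Proof.
by move=> c0 [S uS]; exists (c * S) => n; rewrite -mulr_sumr ler_wpM2l.
Qed.

Lemma bounded_sums_near u v : (forall k, 0 <= v k) ->
  (\forall k \near \oo, u k <= v k) -> bounded_sums v -> bounded_sums u.
Proof.
move=> v0 [N _ uv] [S vS]; exists (\sum_(k < N) `|u k| + S) => n.
apply: (@le_trans _ _ (\sum_(k < n) ((if (k < N)%N then `|u k| else 0) + v k))).
  apply: ler_sum => k _; case: ltnP => [_|Nk].
    by rewrite (le_trans (ler_norm _))// lerDl.
  by rewrite add0r uv.
rewrite big_split/= lerD ?vS//.
rewrite -(big_mkord xpredT (fun k => if (k < N)%N then `|u k| else 0)).
rewrite -(big_mkord xpredT (fun k => `|u k|)).
have [nN|Nn] := leqP n N.
  rewrite (big_cat_nat (leq0n n) nN)/=.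
  rewrite -[leLHS]addr0 lerD ?sumr_ge0//.
  by apply: ler_sum => k _; case: ifP.
rewrite (big_cat_nat (leq0n N) (ltnW Nn))/= [X in _ + X <= _]big_nat_cond.
rewrite [X in _ + X <= _]big1 ?addr0; last first.
  by move=> k; rewrite andbT => /andP[Nk _]; rewrite ltnNge Nk.
by apply: ler_sum_nat => k /andP[_ ->].
Qed.

Lemma bounded_sums_fine (e : nat -> \bar R) : (forall k, 0 <= e k)%E ->
  (\sum_(1 <= k <oo) e k < +oo)%E ->
  bounded_sums (fun k => fine (e k)) /\
  (forall k, (1 <= k)%N -> e k = (fine (e k))%:E).
Proof.
move=> e0 fin.
have partial n : (\sum_(1 <= k < n) e k <= \sum_(1 <= k <oo) e k)%E.
  by apply: nneseries_lim_ge => k _ _; exact: e0.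
have eE k : (1 <= k)%N -> e k = (fine (e k))%:E.
  move=> k1; rewrite fineK// ge0_fin_numE// (le_lt_trans _ fin)//.
  apply: (le_trans _ (partial k.+1)).
  by rewrite big_nat_recr//= leeDr// sume_ge0.
split=> //; exists (fine (e 0) + fine (\sum_(1 <= k <oo) e k)%E) => -[|n].
  by rewrite big_ord0 addr_ge0 ?fine_ge0// nneseries_ge0.
rewrite big_ord_recl/= lerD2l -lee_fin -sumEFin fineK; last first.
  by rewrite ge0_fin_numE// nneseries_ge0.
apply: (le_trans _ (partial n.+1)); rewrite big_add1/= big_mkord.
by apply: lee_sum => i _; rewrite -eE.
Qed.
End bounded_sums.

Section probability.
Context d (T : measurableType d) (R : realType) (mu : probability T R).
Implicit Types A B E X : set T.

Lemma prE A : measurable A -> mu A = (pr mu A)%:E.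
Proof. by move=> mA; rewrite /pr fineK// fin_num_measure. Qed.

Lemma pr_ge0 A : 0 <= pr mu A.
Proof. exact/fine_ge0/measure_ge0. Qed.

Lemma pr_le1 A : measurable A -> pr mu A <= 1.
Proof. by move=> mA; rewrite -lee_fin -prE// probability_le1. Qed.

Lemma pr_le A B : measurable A -> measurable B -> A `<=` B -> pr mu A <= pr mu B.
Proof. by move=> mA mB AB; rewrite -lee_fin -!prE// le_measure// inE. Qed.

Lemma prU_disj A B : measurable A -> measurable B -> A `&` B = set0 ->
  pr mu (A `|` B) = pr mu A + pr mu B.
Proof.
move=> mA mB AB; apply: EFin_inj; rewrite EFinD -!prE//; last exact: measurableU.
by rewrite measureU.
Qed.

Lemma prU_le A B : measurable A -> measurable B ->
  pr mu (A `|` B) <= pr mu A + pr mu B.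
Proof.
move=> mA mB; rewrite -lee_fin EFinD -!prE//; last exact: measurableU.
exact: measureU2.
Qed.

Lemma pr_full X A : measurable X -> mu X = 1%E -> measurable A ->
  pr mu (X `&` A) = pr mu A.
Proof.
move=> mX X1 mA; have mXA : measurable (X `&` A) by exact: measurableI.
have mXC : measurable (~` X) by exact: measurableC.
apply/eqP; rewrite eq_le; apply/andP; split; first by apply: pr_le.
have -> : pr mu (X `&` A) = pr mu (X `&` A) + pr mu (~` X).
  by rewrite [X in _ + X]/pr probability_setC// X1 subee// addr0.
apply: le_trans (prU_le _ _) => //; apply: pr_le => //.
  exact: measurableU.
by move=> x Ax; have [Xx|nXx] := pselect (X x); [left|right].
Qed.

Lemma pr_cover n (A : nat -> set T) E :
  (forall i, measurable (A i)) -> measurable E ->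
  (forall x, E x -> exists2 i, (i < n)%N & A i x) ->
  pr mu E <= \sum_(i < n) pr mu (A i).
Proof.
move=> mA mE EA; rewrite -lee_fin -sumEFin -prE//.
under eq_bigr do rewrite -prE//.
apply: content_subadditive => // x /EA[i ni Aix].
by rewrite -bigcup_mkord; exists i.
Qed.

Lemma pr_pack n (A : nat -> set T) E :
  (forall i, measurable (A i)) -> measurable E -> trivIset setT A ->
  (forall i, A i `<=` E) ->
  \sum_(i < n) pr mu (A i) <= pr mu E.
Proof.
move=> mA mE tA AE; rewrite -lee_fin -sumEFin -prE//.
under eq_bigr do rewrite -prE//.
rewrite -measure_bigsetU// le_measure ?inE//.
  exact: bigsetU_measurable.
by rewrite -bigcup_mkord => x [i _ /AE].
Qed.

Lemma pr_exhaust (W : nat -> set T) E c :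
  (forall n, measurable (W n)) -> measurable E ->
  {homo W : n m / (n <= m)%N >-> n `<=` m} -> \bigcup_n W n = setT ->
  (forall n, pr mu (E `&` W n) <= c) -> pr mu E <= c.
Proof.
move=> mW mE ndW WT Wc; rewrite -lee_fin -prE//.
have EW : \bigcup_n (E `&` W n) = E by rewrite -setI_bigcupr WT setIT.
have mEW n : measurable (E `&` W n) by exact: measurableI.
have := @nondecreasing_cvg_mu _ _ _ mu (fun n => E `&` W n) mEW.
rewrite EW => /(_ mE) h.
have {}h : mu (E `&` W n) @[n --> \oo] --> mu E.
  by apply: h => n m nm; apply/subsetPset; apply: setIS; exact: ndW.
apply: (cvge_to_le h); apply: nearW => n /=.
by rewrite prE// lee_fin.
Qed.

Lemma pr_borel_cantelli (A : nat -> set T) :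
  (forall k, measurable (A k)) -> bounded_sums (fun k => pr mu (A k)) ->
  exists Z, [/\ measurable Z, mu Z = 0%E &
    forall x, ~ Z x -> \forall k \near \oo, ~ A k x].
Proof.
move=> mA [S hS]; exists (lim_sup_set A); split.
- by apply: bigcap_measurable => // k _; apply: bigcup_measurable.
- apply: lim_sup_set_cvg0 => //; apply: (@le_lt_trans _ _ S%:E); last exact: ltry.
  apply: lime_le; first by apply: is_cvg_nneseries.
  apply: nearW => n /=; rewrite big_mkord.
  under eq_bigr do rewrite prE//.
  by rewrite sumEFin lee_fin.
- move=> x; rewrite /lim_sup_set => /existsNP[n /not_implyP[_ h]].
  exists n => // k nk Akx; apply: h; by exists k.
Qed.

End probability.

Arguments prE {d T R} mu {A}.
Arguments pr_ge0 {d T R} mu A.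
Arguments pr_le1 {d T R} mu {A}.
Arguments pr_le {d T R} mu {A B}.
Arguments prU_disj {d T R} mu {A B}.
Arguments prU_le {d T R} mu {A B}.
Arguments pr_full {d T R} mu {X A}.
Arguments pr_cover {d T R} mu {n A E}.
Arguments pr_pack {d T R} mu {n A E}.
Arguments pr_exhaust {d T R} mu W {E c}.
Arguments pr_borel_cantelli {d T R} mu {A}.

(** * The probability of avoiding a set *)

Definition avoid (T : Type) (F : T -> T) (B : set T) (n : nat) : set T :=
  [set x | forall j, (j < n)%N -> ~ B (iter j F x)].

Section avoidance.
Context d (T : measurableType d) (R : realType) (mu : probability T R).
Variable F : T -> T.
Hypothesis mF : measurable_fun setT F.
Hypothesis invF : forall A, measurable A -> pr mu (F @^-1` A) = pr mu A.

Lemma measurable_iter j : measurable_fun setT (iter j F).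
Proof.
elim: j => [|j ih]; first exact: measurable_id.
exact: (measurableT_comp mF ih).
Qed.

Lemma measurable_iter_preimage j A : measurable A ->
  measurable (iter j F @^-1` A).
Proof.
by move=> mA; rewrite -[X in measurable X]setTI; exact: measurable_iter.
Qed.

Variable B : set T.
Hypothesis mB : measurable B.

Lemma measurable_avoid n : measurable (avoid F B n).
Proof.
have -> : avoid F B n = \bigcap_(j in [set j | (j < n)%N]) ~` (iter j F @^-1` B).
  by apply/seteqP; split.
apply: bigcap_measurableType => j _; apply: measurableC.
exact: measurable_iter_preimage.
Qed.

Lemma avoid_anti m n : (m <= n)%N -> avoid F B n `<=` avoid F B m.
Proof. by move=> mn x h j jm; apply: h; exact: leq_trans mn. Qed.

(** The price of a waiting time t in decorrelation: visits to B that are repeated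
    before time t. *)
Definition early_returns (t : nat) : R :=
  \sum_(1 <= j < t) pr mu (B `&` iter j F @^-1` B).

Lemma early_returns_ge0 t : 0 <= early_returns t.
Proof. by apply: sumr_ge0 => j _; exact: pr_ge0. Qed.

(** A point which avoids B for n steps after time 1 either avoids B at
    time 0 as well or lies in B; invariance of the measure turns this
    dichotomy into a one-step recursion. *)
Lemma avoid_step n :
  pr mu (avoid F B n) =
  pr mu (avoid F B n.+1) + pr mu (B `&` F @^-1` avoid F B n).
Proof.
have mA := measurable_avoid.
have mFA : measurable (F @^-1` avoid F B n).
  by apply: (@measurable_iter_preimage 1).
rewrite -[LHS]invF// -prU_disj//; last 2 first.
- exact: measurableI.
- by apply/seteqP; split=> x // [/(_ 0%N isT)/= nB [/nB]].
congr (pr mu _); apply/seteqP; split => x /=.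
- move=> h; have [Bx|nBx] := pselect (B x); first by right.
  by left => -[|j]// jn; rewrite iterSr; exact: h.
- by case=> [h j jn|[]//]; rewrite -iterSr; exact: h.
Qed.

Variables (t : nat) (eps : R).
Hypothesis t_gt0 : (0 < t)%N.
Hypothesis mixB : forall A, measurable A ->
  (pr mu B - eps) * pr mu A <= pr mu (B `&` iter t F @^-1` A).

(** Decorrelation needs a waiting time t.  Dropping the constraint of avoiding
    B between times 1 and t - 1 only adds points that come back early. *)
Lemma avoid_decrease n : (t <= n.+1)%N ->
  (pr mu B - eps) * pr mu (avoid F B (n.+1 - t)) <=
  pr mu (B `&` F @^-1` avoid F B n) + early_returns t.
Proof.
move=> tn; apply: (le_trans (mixB (measurable_avoid _))).
have mA := measurable_avoid.
have mFA : measurable (F @^-1` avoid F B n).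
  by apply: (@measurable_iter_preimage 1).
have mR j : measurable (B `&` iter j F @^-1` B).
  by apply: measurableI => //; exact: measurable_iter_preimage.
have mL : measurable (B `&` iter t F @^-1` avoid F B (n.+1 - t)).
  by apply: measurableI => //; exact: measurable_iter_preimage.
pose U := \bigcup_(j in [set j | (1 <= j < t)%N]) (B `&` iter j F @^-1` B).
have mU : measurable U by exact: bigcup_measurable.
apply: (@le_trans _ _ (pr mu ((B `&` F @^-1` avoid F B n) `|` U))).
  apply: pr_le => //; first by apply: measurableU => //; exact: measurableI.
  move=> x [Bx /= h].
  have [Ux|nUx] := pselect (U x); [by right|left].
  split=> // j jn; rewrite -iterSr => Bj.
  have [jt|tj] := ltnP j.+1 t; first by apply: nUx; exists j.+1.
  apply: (h (j.+1 - t)%N); first by rewrite ltn_sub2r// ltnS (leq_trans tj).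
  by rewrite -iterD subnK.
apply: (le_trans (prU_le mu _ _)) => //; first exact: measurableI.
rewrite lerD2l /early_returns -[t]prednK// big_add1/= big_mkord.
apply: (@pr_cover _ _ _ mu t.-1 (fun j => B `&` iter j.+1 F @^-1` B)) => //.
move=> x [[//|j]/= jt h]; exists j => //.
by rewrite -ltnS prednK.
Qed.

(** Exponential decay of the probability of avoiding B.  Only the decrements
    of n |-> P(avoid n) are compared with a decorrelated product; the cost is
    one additive error [early_returns t] per step. *)
Lemma avoid_exp m :
  pr mu (avoid F B (t.-1 + m)) <=
  expR (- (m%:R * (pr mu B - eps))) + m%:R * early_returns t.
Proof.
set q := pr mu B - eps.
have D0 := early_returns_ge0 t.
have mA := measurable_avoid.
have [q0|q0] := leP 0 q; last first.
  rewrite (le_trans (pr_le1 mu (mA _)))// -[leLHS]addr0 lerD ?mulr_ge0//.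
  by rewrite -expR0 ler_expR oppr_ge0 mulr_ge0_le0// ltW.
(* Each step costs a factor 1 - q, which is at most expR (- q). *)
elim: m => [|m ih].
  by rewrite mul0r oppr0 expR0 mul0r !addr0 pr_le1.
set n := (t.-1 + m)%N in ih *.
have tn : (t <= n.+1)%N by rewrite /n -addSn prednK// leq_addr.
have step : pr mu (avoid F B n.+1) <=
    (1 - q) * pr mu (avoid F B n) + early_returns t.
  have mono : q * pr mu (avoid F B n) <= q * pr mu (avoid F B (n.+1 - t)).
    rewrite ler_wpM2l// pr_le//; apply: avoid_anti.
    by rewrite leq_subLR -addn1 addnC leq_add2r.
  have := avoid_decrease tn; have := avoid_step n; rewrite -/q.
  by move: mono => /=; lra.
rewrite addnS -/n (le_trans step)//.
rewrite -natr1 [(m%:R + 1) * early_returns t]mulrDl mul1r addrA lerD2r.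
apply: (@le_trans _ _ (expR (- q) * pr mu (avoid F B n))).
  by rewrite ler_wpM2r ?pr_ge0// expR_ge1Dx.
apply: (@le_trans _ _ (expR (- q) *
    (expR (- (m%:R * q)) + m%:R * early_returns t))).
  by rewrite ler_wpM2l// expR_ge0.
have -> : - ((m%:R + 1) * q) = - q - m%:R * q by lra.
rewrite mulrDr -expRD lerD2l.
by rewrite ler_piMl ?mulr_ge0// -expR0 ler_expR oppr_le0.
Qed.
End avoidance.

(** * Cells of the real line *)

Lemma ge0_integral_pack d (T : measurableType d) (R : realType)
    (mu : {measure set T -> \bar R}) (D : set T) (A : nat -> set T)
    (g : T -> \bar R) n :
  measurable D -> (forall i, measurable (A i)) -> trivIset setT A ->
  (forall i, A i `<=` D) -> measurable_fun D g ->
  (forall x, D x -> 0 <= g x)%E ->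
  (\sum_(i < n) \int[mu]_(x in A i) g x <= \int[mu]_(x in D) g x)%E.
Proof.
move=> mD mA tA AD mg g0.
have sub : \big[setU/set0]_(i <- index_iota 0 n) A i `<=` D.
  by rewrite big_mkord -bigcup_mkord => x [i _ /AD].
rewrite -(big_mkord xpredT (fun i => \int[mu]_(x in A i) g x)%E).
rewrite -ge0_integral_bigsetU//.
- apply: ge0_subset_integral => //; exact: bigsetU_measurable.
- by rewrite /index_iota iota_uniq.
- exact: sub_trivIset tA.
- exact: measurable_funS mg.
- by move=> x /sub; exact: g0.
Qed.

Lemma measurable_lt_cst d (T : measurableType d) (R : realType) (D : set T)
    (g : T -> R) (a : R) :
  measurable D -> measurable_fun D g -> measurable (D `&` [set x | g x < a]).
Proof.
move=> mD mg.
have -> : D `&` [set x | g x < a] = D `&` g @^-1` `]-oo, a[%classic.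
  by apply/seteqP; split=> x; rewrite /= in_itv.
by apply: mg => //; exact: measurable_itv.
Qed.

Lemma measurable_ge_cst d (T : measurableType d) (R : realType) (D : set T)
    (g : T -> R) (a : R) :
  measurable D -> measurable_fun D g -> measurable (D `&` [set x | a <= g x]).
Proof.
move=> mD mg.
have -> : D `&` [set x | a <= g x] = D `&` g @^-1` `[a, +oo[%classic.
  by apply/seteqP; split=> x; rewrite /= in_itv/= andbT.
by apply: mg => //; exact: measurable_itv.
Qed.

Section cells.
Context {R : realType}.
Implicit Types (b h x : R) (i : nat).

(** Half-open, so that the cells of a given base and length tile a half-line. *)
Definition cell b h i : set R := `[b + i%:R * h, b + i.+1%:R * h[%classic.

Lemma cellP b h i x :
  cell b h i x <-> b + i%:R * h <= x < b + i.+1%:R * h.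
Proof. by rewrite /cell/= in_itv. Qed.

Lemma measurable_cell b h i : measurable (cell b h i).
Proof. exact: measurable_itv. Qed.

Lemma cell_dist b h i x y : cell b h i x -> cell b h i y -> `|x - y| < h.
Proof.
move=> /cellP/andP[x1 x2] /cellP/andP[y1 y2].
by rewrite ltr_norml; move: x1 x2 y1 y2; rewrite -natr1; lra.
Qed.

Lemma trivIset_cell b h : 0 < h -> trivIset setT (cell b h).
Proof.
move=> h0; apply/trivIsetP => i j _ _ ij.
wlog ltij : i j ij / (i < j)%N => [hw|].
  case: (ltngtP i j) => [|ji|eij]; first exact: hw.
    by rewrite setIC; apply: hw => //; rewrite eq_sym.
  by rewrite eij eqxx in ij.
apply/seteqP; split=> x //= -[/cellP/andP[_ x2] /cellP/andP[x1 _]].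
have : i.+1%:R * h <= j%:R * h by rewrite ler_wpM2r ?ler_nat// ltW.
by lra.
Qed.

Lemma cell_cover b h N x : 0 < h -> b <= x < b + N%:R * h ->
  exists2 i, (i < N)%N & cell b h i x.
Proof.
move=> h0 /andP[bx xb].
have q0 : 0 <= (x - b) / h by rewrite divr_ge0 ?subr_ge0 ?(ltW h0).
have /andP[t1 t2] := truncn_itv q0.
exists (Num.truncn ((x - b) / h)).
  by rewrite truncn_lt_nat// ltr_pdivrMr//; lra.
apply/cellP; move: t1 t2.
by rewrite ler_pdivlMr// ltr_pdivrMr// => t1 t2; apply/andP; split; lra.
Qed.

(** By continuity of the measure along the increasing runs from - n h to n h. *)
Lemma pr_runs (mu : probability R R) (E : set R) h c :
  0 < h -> measurable E ->
  (forall b N, pr mu (E `&` `[b, b + N%:R * h[) <= c) -> pr mu E <= c.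
Proof.
move=> h0 mE Ec.
pose W (n : nat) : set R := `[- (n%:R * h), - (n%:R * h) + (n.*2)%:R * h[%classic.
have WE n x : W n x <-> - (n%:R * h) <= x < n%:R * h.
  by rewrite /W/= in_itv/= -addnn natrD mulrDl addKr.
apply: (@pr_exhaust _ _ _ mu W) => //.
- by move=> n; exact: measurable_itv.
- move=> m n mn x /WE/andP[x1 x2]; apply/WE.
  have : m%:R * h <= n%:R * h by rewrite ler_wpM2r ?ler_nat// ltW.
  by move: x1 x2; lra.
- apply/seteqP; split=> // x _; exists (Num.truncn (`|x| / h)).+1 => //; apply/WE.
  have := truncnS_gt (`|x| / h); rewrite ltr_pdivrMr// => xh.
  by move: xh; rewrite ltr_norml => /andP[]; lra.
- by move=> n; exact: Ec.
Qed.

Lemma ball_cell b h i x : cell b h i x -> cell b h i `<=` ball x h.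
Proof. by move=> xi y yi; exact: cell_dist xi yi. Qed.

Lemma measurable_pr_ball (mu : probability R R) (X : set R) r :
  measurable X -> measurable_fun setT (fun x => mu (X `&` ball x r)).
Proof.
move=> mX.
pose A : set (R * R) :=
  (setT `*` X) `&` [set p : R * R | `|p.1 - p.2| < r].
have mA : measurable A.
  apply: measurableI; first exact: measurableX.
  have mf : measurable_fun setT (fun p : R * R => `|p.1 - p.2|).
    apply: measurableT_comp => //; apply: measurable_funB => //.
  have -> : [set p : R * R | `|p.1 - p.2| < r] =
      (fun p : R * R => `|p.1 - p.2|) @^-1` `]-oo, r[%classic.
    by apply/seteqP; split=> p /=; rewrite in_itv.
  by rewrite -[X in measurable X]setTI; exact: mf.
have := measurable_fun_xsection mu mA.
apply: eq_measurable_fun => x _ /=; congr (mu _).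
apply/seteqP; split => y; rewrite /xsection/= inE /A/= /ball/=; tauto.
Qed.

(** A cell of length r is contained in the ball of radius r around each of its
    points. *)
Lemma sum_sqr_cell_le (mu : probability R R) (X : set R)
    b r n :
  0 < r -> measurable X -> mu X = 1%E ->
  ((\sum_(i < n) pr mu (cell b r i) ^+ 2)%:E <=
   \int[mu]_(x in X) mu (X `&` ball x r))%E.
Proof.
move=> r0 mX X1.
have mc := measurable_cell b r.
have mXc i : measurable (X `&` cell b r i) by exact: measurableI.
have full i : mu (X `&` cell b r i) = (pr mu (cell b r i))%:E.
  by rewrite (prE mu)// pr_full.
have mball : measurable_fun X (fun x => mu (X `&` ball x r)).
  exact: measurable_funTS (measurable_pr_ball mu r mX).
have mXb x : measurable (X `&` ball x r).
  by apply: measurableI => //; exact: measurable_ball.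
apply: le_trans (@ge0_integral_pack _ _ _ mu X (fun i => X `&` cell b r i)
  _ n _ _ _ _ _ _) => //.
- rewrite -sumEFin; apply: lee_sum => i _.
  apply: (@le_trans _ _
    (\int[mu]_(x in X `&` cell b r i) (pr mu (cell b r i))%:E)%E).
    by rewrite integral_cst//= full -EFinM expr2.
  apply: ge0_le_integral => //.
  + by move=> x _; rewrite lee_fin pr_ge0.
  + by apply: measurable_funS mball => // x [].
  + move=> x [Xx cx]; rewrite -full le_measure ?inE//.
    by apply: setIS; exact: ball_cell.
- by apply: trivIset_setIl; exact: trivIset_cell.
Qed.
End cells.

(** * Returns at a given time *)

Section wide_cells.
Context {R : realType}.
Implicit Types (b h x y : R) (i m : nat).

(** The cell of index i together with m neighbouring cells on each side. *)
Definition wide b h m i : set R :=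
  `[b + i%:R * h - m%:R * h, b + i.+1%:R * h + m%:R * h[%classic.

Lemma wideP b h m i x : wide b h m i x <->
  b + i%:R * h - m%:R * h <= x < b + i.+1%:R * h + m%:R * h.
Proof. by rewrite /wide/= in_itv. Qed.

Lemma measurable_wide b h m i : measurable (wide b h m i).
Proof. exact: measurable_itv. Qed.

Lemma wide_length b h m i :
  (b + i.+1%:R * h + m%:R * h) - (b + i%:R * h - m%:R * h) =
  (m.*2.+1)%:R * h.
Proof. by rewrite -addnn -!natr1 natrD; ring. Qed.

Lemma wide_dist b h m i x y : wide b h m i x -> wide b h m i y ->
  `|x - y| < (m.*2.+1)%:R * h.
Proof.
move=> /wideP/andP[x1 x2] /wideP/andP[y1 y2].
by rewrite -(wide_length b h m i) ltr_norml; move: x1 x2 y1 y2; lra.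
Qed.

Lemma cell_sub_wide b h m i : 0 <= h -> cell b h i `<=` wide b h m i.
Proof.
move=> h0 x /cellP/andP[x1 x2]; apply/wideP.
have : 0 <= m%:R * h by rewrite mulr_ge0.
by move: x1 x2 => ? ? ?; apply/andP; split; lra.
Qed.

Lemma cell_wide_dist b h m i x y : 0 <= h ->
  cell b h i x -> wide b h m i y -> `|x - y| < m.+1%:R * h.
Proof.
move=> h0 /cellP/andP[x1 x2] /wideP/andP[y1 y2]; rewrite ltr_norml.
by move: x1 x2 y1 y2; rewrite -!natr1; lra.
Qed.

Lemma cell_near_wide b h m i x y : 0 <= h ->
  cell b h i x -> `|x - y| <= m%:R * h -> wide b h m i y.
Proof.
move=> h0 /cellP/andP[x1 x2]; rewrite ler_norml => /andP[y1 y2]; apply/wideP.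
by apply/andP; split; lra.
Qed.

(** The pieces of the wide cells that have the same position l form one more
    family of consecutive cells, hence a disjoint one. *)
Lemma wide_cells b h m i x : 0 < h -> wide b h m i x ->
  exists2 l, (l < m.*2.+1)%N & cell (b - m%:R * h + l%:R * h) h i x.
Proof.
move=> h0 /wideP xW.
have [|l lm /cellP xl] := @cell_cover _ (b + i%:R * h - m%:R * h) h m.*2.+1 x h0.
  by rewrite -(wide_length b h m i) [X in _ < X]addrC subrK.
exists l => //; apply/cellP; move: xl; rewrite -!natr1 => /andP[x1 x2].
by apply/andP; split; lra.
Qed.

Lemma pr_wide_le (mu : probability R R) (E : set R) b h m i :
  0 < h -> measurable E ->
  pr mu (E `&` wide b h m i) <=
  \sum_(l < m.*2.+1) pr mu (E `&` cell (b - m%:R * h + l%:R * h) h i).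
Proof.
move=> h0 mE.
apply: (pr_cover mu (A := fun l => E `&` cell (b - m%:R * h + l%:R * h) h i)).
- by move=> l; apply: measurableI => //; exact: measurable_cell.
- by apply: measurableI => //; exact: measurable_wide.
- by move=> x [Ex /(wide_cells h0)[l lm xl]]; exists l.
Qed.

Lemma sum_cell_le (mu : probability R R) (E : set R) b h n :
  0 < h -> measurable E ->
  \sum_(i < n) pr mu (E `&` cell b h i) <= pr mu E.
Proof.
move=> h0 mE; apply: (pr_pack mu (A := fun i => E `&` cell b h i)) => //.
- by move=> i; apply: measurableI => //; exact: measurable_cell.
- by apply: trivIset_setIl; exact: trivIset_cell.
Qed.

Lemma sum_wide_le (mu : probability R R) (E : set R) b h m n :
  0 < h -> measurable E ->
  \sum_(i < n) pr mu (E `&` wide b h m i) <= (m.*2.+1)%:R * pr mu E.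
Proof.
move=> h0 mE.
apply: (@le_trans _ _ (\sum_(i < n) \sum_(l < m.*2.+1)
    pr mu (E `&` cell (b - m%:R * h + l%:R * h) h i))).
  by apply: ler_sum => i _; exact: pr_wide_le.
rewrite exchange_big/=.
rewrite (le_trans (ler_sum _ (fun l _ => sum_cell_le mu _ n h0 mE)))//.
by rewrite sumr_const card_ord mulr_natl.
Qed.
End wide_cells.

Definition return_set (R : realType) (F : R -> R) (j : nat) (r : R) : set R :=
  [set x | `|x - iter j F x| <= r].

Section returns.
Context {R : realType} (mu : probability R R) (F : R -> R).
Hypothesis mF : measurable_fun setT F.
Variable Theta : nat -> R.
Hypothesis Theta_ge0 : forall j, 0 <= Theta j.
Hypothesis mixF : forall (a b : R) j (A : set R), measurable A ->
  `|pr mu (`[a, b[ `&` iter j F @^-1` A) - pr mu `[a, b[ * pr mu A| <=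
  Theta j * pr mu A.

Lemma measurable_displacement (j : nat) :
  measurable_fun setT (fun x : R => `|x - iter j F x|).
Proof.
apply: measurableT_comp => //; apply: measurable_funB => //.
exact: (measurable_iter mF j).
Qed.

Lemma measurable_return_set j r : measurable (return_set F j r).
Proof.
have -> : return_set F j r =
    (fun x : R => `|x - iter j F x|) @^-1` `]-oo, r]%classic.
  by apply/seteqP; split=> x; rewrite /return_set/= in_itv.
rewrite -[X in measurable X]setTI; exact: measurable_displacement.
Qed.

(** Cells of length r reduce a return of order r to a visit of the enlarged
    cell, and decorrelation bounds the latter by a product of masses; the
    products of masses of neighbouring cells are dominated by squares. *)
Lemma pr_return_set_le (X : set R) k r Q :
  0 < r -> measurable X -> mu X = 1%E ->
  (\int[mu]_(x in X) mu (X `&` ball x r) <= Q%:E)%E ->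
  pr mu (return_set F k r) <= 3 * Q + 3 * Theta k.
Proof.
move=> r0 mX X1 hQ.
have mE := measurable_return_set k r.
apply: (pr_runs r0 mE) => b N.
have mcell := measurable_cell b r.
have mwide := measurable_wide b r 1.
have mpre i : measurable (iter k F @^-1` wide b r 1 i).
  exact: measurable_iter_preimage.
pose c (l i : nat) := pr mu (cell (b - 1%:R * r + l%:R * r) r i).
have sq (b' : R) : \sum_(i < N) pr mu (cell b' r i) ^+ 2 <= Q.
  by rewrite -lee_fin (le_trans _ hQ)// sum_sqr_cell_le.
have wc i : pr mu (wide b r 1 i) <= \sum_(l < 3) c l i.
  rewrite -[wide b r 1 i]setTI (le_trans (pr_wide_le mu b 1 i r0 measurableT))//.
  by apply: ler_sum => l _; rewrite setTI.
apply: (@le_trans _ _ (\sum_(i < N)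
    pr mu (cell b r i `&` iter k F @^-1` wide b r 1 i))).
  apply: (pr_cover mu (A := fun i => cell b r i `&` iter k F @^-1` wide b r 1 i)).
  - by move=> i; exact: measurableI.
  - by apply: measurableI => //; exact: measurable_itv.
  - move=> x [Ex]; rewrite /= in_itv/= => /(cell_cover r0)[i iN xi].
    exists i => //; split=> //=; apply: cell_near_wide xi _; first exact: ltW.
    by rewrite mul1r.
have term (i : nat) : pr mu (cell b r i `&` iter k F @^-1` wide b r 1 i) <=
    \sum_(l < 3) ((pr mu (cell b r i) ^+ 2 + c l i ^+ 2) / 2 + Theta k * c l i).
  have := mixF (b + i%:R * r) (b + i.+1%:R * r) k (mwide i).
  rewrite ler_norml => /andP[_]; rewrite lerBlDl -/(cell b r i) => /le_trans; apply.
  rewrite -mulrDl (le_trans (ler_wpM2l _ (wc i)))//.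
    by rewrite addr_ge0// pr_ge0.
  rewrite mulr_sumr; apply: ler_sum => l _.
  rewrite mulrDl lerD2r.
  by have := sqr_ge0 (pr mu (cell b r i) - c l i); rewrite sqrrB; lra.
apply: (le_trans (ler_sum _ (fun (i : 'I_N) _ => term i))).
rewrite exchange_big/=.
apply: (@le_trans _ _ (\sum_(l < 3) (Q + Theta k))).
  apply: ler_sum => l _; rewrite big_split/= lerD//.
    rewrite -mulr_suml big_split/=.
    by have := sq b; have := sq (b - 1%:R * r + l%:R * r); rewrite /c; lra.
  rewrite -mulr_sumr ler_piMr//.
  have := sum_cell_le mu (b - 1%:R * r + l%:R * r) N r0 measurableT.
  under eq_bigr do rewrite setTI.
  by move=> /le_trans; apply; exact: pr_le1.
by rewrite sumr_const card_ord -mulr_natl; lra.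
Qed.
End returns.

(** * Absence of returns up to a given time *)

(** The points of an interval which are within r of its complement on a given
    side are within r of each other. *)
Lemma pr_edge_le (R : realType) (mu : probability R R) (X : set R) (M r : R) :
  is_interval X -> 0 < r -> 0 <= M ->
  (forall a b : R, a <= b -> pr mu `[a, b[ <= M * (b - a)) ->
  exists Z : set R, [/\ measurable Z, pr mu Z <= 8 * M * r &
    forall x, X x -> ~ Z x -> ball x r `<=` X].
Proof.
move=> itvX r0 M0 massM.
pose L : set R := [set x | X x /\ exists y, [/\ y < x, x - y < r & ~ X y]].
pose U : set R := [set x | X x /\ exists y, [/\ x < y, y - x < r & ~ X y]].
have close (E : set R) : (forall x x', E x -> E x' -> `|x - x'| <= r) ->
    exists Z : set R, [/\ measurable Z, pr mu Z <= 4 * M * r & E `<=` Z].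
  move=> Er; have [[x0 Ex0]|nE] := pselect (exists x, E x).
    exists `[x0 - 2 * r, x0 + 2 * r[%classic; split; first exact: measurable_itv.
    - by apply: (le_trans (massM _ _ _)); nra.
    - move=> x Ex; have := Er _ _ Ex Ex0; rewrite ler_norml /= in_itv/=.
      by move=> /andP[? ?]; apply/andP; split; lra.
  exists set0; split => //.
  - by rewrite /pr measure0/= !mulr_ge0// ltW.
  - by move=> x Ex; case: nE; exists x.
have [|Z1 [mZ1 Z1r LZ1]] := close L.
  move=> x x'; wlog xx' : x x' / x <= x'.
    move=> hw; have [xx'|/ltW x'x] := leP x x'; first exact: hw.
    by move=> Lx Lx'; rewrite distrC; exact: hw.
  move=> [Xx [y [yx xy nXy]]] [Xx' [y' [y'x' x'y' nXy']]].
  rewrite distrC ger0_norm ?subr_ge0// leNgt; apply/negP => h; apply: nXy'.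
  by apply: (itvX x x') => //; apply/andP; split; lra.
have [|Z2 [mZ2 Z2r UZ2]] := close U.
  move=> x x'; wlog xx' : x x' / x <= x'.
    move=> hw; have [xx'|/ltW x'x] := leP x x'; first exact: hw.
    by move=> Lx Lx'; rewrite distrC; exact: hw.
  move=> [Xx [y [yx xy nXy]]] [Xx' [y' [y'x' x'y' nXy']]].
  rewrite distrC ger0_norm ?subr_ge0// leNgt; apply/negP => h; apply: nXy.
  by apply: (itvX x x') => //; apply/andP; split; lra.
exists (Z1 `|` Z2); split; first exact: measurableU.
  by apply: (le_trans (prU_le mu _ _)) => //; lra.
move=> x Xx nZ y; rewrite /ball/= ltr_norml => /andP[y1 y2].
apply: contrapT => nXy; apply: nZ.
have [yx|xy|yx] := ltgtP y x.
- by left; apply: LZ1; split=> //; exists y; split => //; lra.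
- by right; apply: UZ2; split=> //; exists y; split => //; lra.
- by rewrite yx in nXy.
Qed.

Definition no_return (R : realType) (F : R -> R) (n : nat) (r : R) : set R :=
  [set x | forall k, (1 <= k <= n)%N -> r < `|x - iter k F x|].

Section no_return_estimate.
Context {R : realType} (mu : probability R R) (F : R -> R).
Hypothesis mF : measurable_fun setT F.
Hypothesis invF :
  forall A : set R, measurable A -> pr mu (F @^-1` A) = pr mu A.
Variable Theta : nat -> R.
Hypothesis Theta_ge0 : forall j, 0 <= Theta j.
Hypothesis mixF : forall (a b : R) j (A : set R), measurable A ->
  `|pr mu (`[a, b[ `&` iter j F @^-1` A) - pr mu `[a, b[ * pr mu A| <=
  Theta j * pr mu A.

Lemma measurable_no_return n r : measurable (no_return F n r).
Proof.
have -> : no_return F n r =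
    \bigcap_(k in [set k | (1 <= k <= n)%N]) ~` return_set F k r.
  apply/seteqP; split=> x h k kn; have := h k kn.
    by rewrite /return_set/= ltNge => /negP.
  by rewrite /return_set/setC/= ltNge => /negP.
apply: bigcap_measurableType => k _; apply: measurableC.
exact: measurable_return_set.
Qed.

Variables (X : set R) (lam : {measure set R -> \bar R}) (rho g : R -> R) (M : R).
Hypothesis itvX : is_interval X.
Hypothesis M_ge0 : 0 <= M.
Hypothesis massM : forall a b : R, a <= b -> pr mu `[a, b[ <= M * (b - a).
Hypothesis mrho : measurable_fun X rho.
Hypothesis rho_ge0 : forall x, X x -> 0 <= rho x.
Hypothesis density : forall A : set R, measurable A -> A `<=` X ->
  mu A = (\int[lam]_(x in A) (rho x)%:E)%E.
Hypothesis mg : measurable_fun X g.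

(** All points of the wide cell are within distance (m+1) h of the starting
    point, so an orbit without return within that distance avoids the wide
    cell.  After t steps it has forgotten its start, whence a product. *)
Lemma pr_cell_no_return b h m i n t :
  0 < h -> (0 < t)%N -> (t.*2 <= n)%N ->
  pr mu (cell b h i `&` no_return F n (m.+1%:R * h)) <=
  pr mu (cell b h i) *
    (expR (- ((n - t.*2)%:R * pr mu (wide b h m i)) + n%:R * Theta t) +
     n%:R * early_returns mu F (wide b h m i) t) + Theta t.
Proof.
move=> h0 t0 tn.
set W := wide b h m i; set p := pr mu (cell b h i).
have mW : measurable W by exact: measurable_wide.
have mc : measurable (cell b h i) by exact: measurable_cell.
(* Avoidance is required from time t to time n, that is for n + 1 - t steps,
   of which [avoid_exp] does not use the first t - 1. *)
pose s := (n.+2 - t.*2)%N.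
have mA : measurable (avoid F W (t.-1 + s)) by exact: measurable_avoid.
have p0 : 0 <= p by exact: pr_ge0.
have p1 : pr mu (avoid F W (t.-1 + s)) <= 1 by exact: pr_le1.
have mixW A : measurable A ->
    (pr mu W - Theta t) * pr mu A <= pr mu (W `&` iter t F @^-1` A).
  move=> mA'; have := @mixF (b + i%:R * h - m%:R * h)
    (b + i.+1%:R * h + m%:R * h) t A mA'.
  by rewrite -/(wide b h m i) -/W ler_norml mulrBl => /andP[h1 _]; lra.
have aW := avoid_exp mF invF mW t0 mixW s.
have sn : (n - t.*2)%:R <= s%:R :> R by rewrite ler_nat leq_sub2r// ltnW.
have sn' : s%:R <= n%:R :> R by rewrite ler_nat /s; lia.
have W0 : 0 <= pr mu W by exact: pr_ge0.
have aW' : pr mu (avoid F W (t.-1 + s)) <=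
    expR (- ((n - t.*2)%:R * pr mu W) + n%:R * Theta t) +
    n%:R * early_returns mu F W t.
  apply: (le_trans aW); apply: lerD.
    rewrite ler_expR mulrBr opprB addrC lerD ?ler_wpM2r//.
    by rewrite lerN2 ler_wpM2r.
  by rewrite ler_wpM2r ?early_returns_ge0.
apply: (@le_trans _ _ (pr mu (cell b h i `&` iter t F @^-1` avoid F W (t.-1 + s)))).
  apply: pr_le.
  - by apply: measurableI => //; exact: measurable_no_return.
  - by apply: measurableI => //; exact: measurable_iter_preimage.
  - move=> x [xi nr]; split=> // j js Wj.
    have /nr : (1 <= j + t <= n)%N by rewrite /s in js; lia.
    rewrite iterD ltNge => /negP; apply.
    by rewrite ltW//; exact: cell_wide_dist (ltW h0) xi Wj.
have := @mixF (b + i%:R * h) (b + i.+1%:R * h) t _ mA.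
rewrite -/(cell b h i) -/p ler_norml => /andP[_].
rewrite lerBlDl => /le_trans; apply.
apply: lerD; first exact: ler_wpM2l.
by rewrite ler_piMr.
Qed.

(** Two points of the wide cell are within distance 2 (m+1) h. *)
Lemma early_returns_wide b h m i t : 0 < h ->
  early_returns mu F (wide b h m i) t <=
  \sum_(1 <= j < t) pr mu (return_set F j (m.+1.*2%:R * h) `&` wide b h m i).
Proof.
move=> h0; apply: ler_sum => j _.
have mW := measurable_wide b h m i.
apply: pr_le.
- by apply: measurableI => //; exact: measurable_iter_preimage.
- by apply: measurableI => //; exact: measurable_return_set.
- move=> x [Wx Wj]; split=> //; apply/ltW/(lt_le_trans (wide_dist Wx Wj)).
  by rewrite ler_wpM2r ?ler_nat ?(ltW h0)//; lia.
Qed.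

Variables (h : R) (m : nat).
Hypothesis h_gt0 : 0 < h.
(** A lower bound for the mean density over intervals of the size of the wide
    cells; it will be a constant when the density is bounded below, and the
    density minus a small error when the density is Holder continuous. *)
Hypothesis g_mass : forall a b x : R, `[a, b[ `<=` X -> a <= x < b ->
  b - a <= 2 * (m.+1%:R * h) -> g x * (b - a) <= pr mu `[a, b[.

Let mX : measurable X. Proof. exact: (is_interval_measurable itvX). Qed.

(** The points near the boundary of X and those where g is small are discarded.
    Each cell that meets the rest has mass at least theta h, so there are at
    most 1 / (theta h) of them, which bounds the sum of the additive
    decorrelation errors.  On such a cell the bound of [pr_cell_no_return]
    integrates to the density term, and the early returns add up because each
    point belongs to at most 2 m + 1 wide cells. *)
Lemma pr_no_return_le n t (theta S : R) :
  (0 < t)%N -> (t.*2 <= n)%N -> 0 < theta ->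
  (\int[lam]_(x in X)
     (rho x * expR (- ((n - t.*2)%:R * (m.*2.+1)%:R * h * g x)))%:E <= S%:E)%E ->
  pr mu (X `&` no_return F n (m.+1%:R * h)) <=
    8 * M * (m.+1%:R * h) + pr mu (X `&` [set x | g x < theta])
    + (expR (n%:R * Theta t) * S + Theta t / (theta * h)
    + M * h * n%:R * (m.*2.+1)%:R *
      \sum_(1 <= j < t) pr mu (return_set F j (m.+1.*2%:R * h))).
Proof.
move=> t0 tn theta0 intS.
set r := m.+1%:R * h.
have r0 : 0 < r by rewrite mulr_gt0.
have [Z [mZ Zr XZ]] := pr_edge_le itvX r0 M_ge0 massM.
have mNR := measurable_no_return n r.
have mlow : measurable (X `&` [set x | g x < theta]).
  exact: measurable_lt_cst.
have mhigh : measurable (X `&` [set x | theta <= g x]).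
  exact: measurable_ge_cst.
pose E := (X `&` [set x | theta <= g x]) `&` (no_return F n r `\` Z).
have mE : measurable E by apply: measurableI => //; exact: measurableD.
have split3 : pr mu (X `&` no_return F n r) <=
    pr mu Z + pr mu (X `&` [set x | g x < theta]) + pr mu E.
  apply: le_trans (lerD (prU_le mu mZ mlow) (lexx _)).
  apply: le_trans (prU_le mu _ mE); last exact: measurableU.
  apply: pr_le; first exact: measurableI.
    by apply: measurableU => //; exact: measurableU.
  move=> x [Xx nrx]; have [Zx|nZx] := pselect (Z x); first by left; left.
  have [gx|gx] := ltP (g x) theta; first by left; right.
  by right.
apply: (le_trans split3); apply: lerD; first by rewrite lerD2r.
apply: (pr_runs h_gt0 mE) => b N.
have mc := measurable_cell b h.
have mW := measurable_wide b h m.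
pose good (i : nat) := exists x, (E `&` cell b h i) x.
pose A (i : nat) : set R := if `[< good i >] then cell b h i else set0.
have mA i : measurable (A i) by rewrite /A; case: ifP.
have tA : trivIset setT A.
  apply: (@sub_trivIset _ _ setT setT) => //.
  apply/trivIsetP => i j _ _ ij; rewrite /A.
  case: ifP => _; case: ifP => _; rewrite ?set0I ?setI0//.
  by move/trivIsetP: (@trivIset_cell _ b h h_gt0); exact.
have goodW i : good i -> wide b h m i `<=` X.
  move=> [x [[[Xx _] [_ nZx]] xi]] y Wy; apply: (XZ x) => //.
  exact: cell_wide_dist (ltW h_gt0) xi Wy.
have AX i : A i `<=` X.
  rewrite /A; case: ifPn => [/asboolP gi|_ //].
  by move=> x xi; exact: (goodW _ gi) (cell_sub_wide m (ltW h_gt0) xi).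
pose phi x := rho x * expR (- ((n - t.*2)%:R * (m.*2.+1)%:R * h * g x)).
have mphi : measurable_fun X (EFin \o phi).
  apply/measurable_EFinP; apply: measurable_funM => //.
  apply: measurableT_comp => //; apply: measurable_funN.
  exact: measurable_funM.
have phi0 x : X x -> (0 <= (phi x)%:E)%E.
  by move=> Xx; rewrite lee_fin mulr_ge0 ?expR_ge0 ?rho_ge0.
pose J i := fine (\int[lam]_(x in A i) (phi x)%:E)%E.
have J0 i : (0 <= \int[lam]_(x in A i) (phi x)%:E)%E.
  by apply: integral_ge0 => x /AX; exact: phi0.
have JE i : (\int[lam]_(x in A i) (phi x)%:E)%E = (J i)%:E.
  rewrite /J fineK// ge0_fin_numE//.
  apply: (@le_lt_trans _ _ S%:E); last exact: ltry.
  apply: le_trans intS; apply: ge0_subset_integral => //; exact: AX.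
have sumJ : \sum_(i < N) J i <= S.
  rewrite -lee_fin (le_trans _ intS)// -sumEFin.
  under eq_bigr do rewrite -JE.
  exact: ge0_integral_pack.
have sumA : \sum_(i < N) pr mu (A i) <= 1.
  apply: (@le_trans _ _ (pr mu X)); first exact: (pr_pack mu).
  exact: pr_le1.
have Jge i : good i ->
    pr mu (cell b h i) * expR (- ((n - t.*2)%:R * pr mu (wide b h m i))) <= J i.
  move=> gi.
  have Ai : A i = cell b h i by rewrite /A asboolT.
  rewrite -lee_fin -JE Ai mulrC EFinM -(prE mu)// density//; last by rewrite -Ai.
  rewrite -ge0_integralZl//; last 2 first.
  - by apply/measurable_EFinP; apply: measurable_funS mrho => //; rewrite -Ai.
  - by move=> y; rewrite -Ai => /AX Xy; rewrite lee_fin rho_ge0.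
  apply: ge0_le_integral => //.
  - move=> y; rewrite -Ai => /AX Xy.
    by rewrite -EFinM lee_fin mulr_ge0 ?expR_ge0 ?rho_ge0.
  - apply: measurable_funeM.
    by apply/measurable_EFinP; apply: measurable_funS mrho => //; rewrite -Ai.
  - by apply: measurable_funS mphi => //; rewrite -Ai.
  - move=> y cy; have Xy : X y by apply: (AX i); rewrite Ai.
    rewrite -EFinM lee_fin mulrC ler_wpM2l ?rho_ge0//.
    rewrite ler_expR lerN2 -!mulrA ler_wpM2l//.
    have -> : m.*2.+1%:R * (h * g y) = g y *
        (b + i.+1%:R * h + m%:R * h - (b + i%:R * h - m%:R * h)).
      by rewrite wide_length; ring.
    apply: g_mass; first exact: goodW gi.
      by apply/wideP; exact: cell_sub_wide (ltW h_gt0) _ cy.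
    by rewrite wide_length mulrA -natrM ler_wpM2r ?ler_nat ?(ltW h_gt0)//; lia.
pose ER i := \sum_(1 <= j < t)
  pr mu (return_set F j (m.+1.*2%:R * h) `&` wide b h m i).
have ER0 i : 0 <= ER i by apply: sumr_ge0 => j _; exact: pr_ge0.
have Mh0 : 0 <= M * h * n%:R by rewrite !mulr_ge0// ltW.
have th0 : 0 < theta * h by exact: mulr_gt0.
have term i : pr mu (E `&` cell b h i) <= expR (n%:R * Theta t) * J i +
    Theta t / (theta * h) * pr mu (A i) + M * h * n%:R * ER i.
  have [gi|ngi] := pselect (good i); last first.
    have -> : E `&` cell b h i = set0.
      by apply/seteqP; split=> // x Ex; apply: ngi; exists x.
    rewrite {1}/pr measure0/= !addr_ge0// mulr_ge0 ?expR_ge0 ?pr_ge0//.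
      by rewrite /J fine_ge0.
    by rewrite divr_ge0// ltW.
  have Ai : A i = cell b h i by rewrite /A asboolT.
  have [x [Ex xi]] := gi.
  have pM : pr mu (cell b h i) <= M * h.
    apply: (le_trans (massM _)); first by rewrite lerD2l ler_wpM2r ?ler_nat ?ltW.
    by rewrite -natr1 opprD addrACA subrr add0r -mulrBl [_ + 1]addrC addrK mul1r.
  have pth : theta * h <= pr mu (cell b h i).
    have gx : theta <= g x by case: Ex => -[].
    apply: (@le_trans _ _ (g x * h)); first by rewrite ler_wpM2r// ltW.
    have E1 : b + i.+1%:R * h - (b + i%:R * h) = h by rewrite -natr1; ring.
    have := @g_mass (b + i%:R * h) (b + i.+1%:R * h) x.
    rewrite E1; apply.
    - by move=> y cy; apply: (AX i); rewrite Ai.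
    - exact/cellP.
    - rewrite mulrA ler_peMl ?(ltW h_gt0)// -natrM.
      by rewrite -[1]/(1%:R) ler_nat muln_gt0.
  apply: (@le_trans _ _ (pr mu (cell b h i `&` no_return F n r))).
    apply: pr_le; [exact: measurableI|exact: measurableI|].
    by move=> y [[_ [nry _]] yi].
  apply: (le_trans (pr_cell_no_return b m i h_gt0 t0 tn)).
  rewrite mulrDr -addrA [_ + Theta t]addrC addrA; apply: lerD; first apply: lerD.
  - by rewrite expRD mulrA [leRHS]mulrC ler_wpM2r ?expR_ge0 ?(Jge i).
  - by rewrite Ai -mulrA ler_peMr// mulrC ler_pdivlMr// mul1r.
  - rewrite mulrA; apply: ler_pM => //.
    + by rewrite mulr_ge0// pr_ge0.
    + exact: early_returns_ge0.
    + by rewrite ler_wpM2r.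
    + exact: early_returns_wide.
apply: (@le_trans _ _ (\sum_(i < N) pr mu (E `&` cell b h i))).
  apply: (pr_cover mu (A := fun i => E `&` cell b h i)).
  - by move=> i; exact: measurableI.
  - by apply: measurableI => //; exact: measurable_itv.
  - move=> x [Ex]; rewrite /= in_itv/= => /(cell_cover h_gt0)[i iN xi].
    by exists i.
apply: (le_trans (ler_sum _ (fun (i : 'I_N) _ => term i))).
rewrite !big_split/= -!mulr_sumr; apply: lerD; first apply: lerD.
- by rewrite ler_wpM2l ?expR_ge0.
- by rewrite ler_piMr// divr_ge0// ltW.
- rewrite -[leRHS]mulrA ler_wpM2l// /ER exchange_big/= mulr_sumr.
  apply: ler_sum => j _; apply: sum_wide_le => //.
  exact: measurable_return_set.
Qed.
End no_return_estimate.

(** * Asymptotics of powers, exponentials and logarithms *)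

Section asymptotics.
Context {R : realType}.
Implicit Types a b C eps : R.

Lemma near_natr_ge C : \forall k \near \oo, C <= k%:R.
Proof. exact: nbhs_infty_ger. Qed.

(** Comparison with a telescoping sum: s k^(-s-1) is at most
    (k-1)^(-s) - k^(-s), by the inequality expR x >= 1 + x. *)
Lemma bounded_sums_powRN p : 1 < p ->
  bounded_sums (fun k => k%:R `^ (- p) : R).
Proof.
move=> p1; set s := p - 1; have s0 : 0 < s by rewrite subr_gt0.
have step (k : nat) : (0 < k)%N ->
    k.+1%:R `^ (- p) <= s^-1 * (k%:R `^ (- s) - k.+1%:R `^ (- s)).
  move=> k0; set a : R := k%:R; set b : R := k.+1%:R.
  have a0 : 0 < a by rewrite ltr0n.
  have b0 : 0 < b by rewrite ltr0n.
  have ab : a / b = 1 + - b^-1.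
    have -> : a = b - 1 by rewrite /a /b -natr1 addrK.
    by rewrite mulrBl divff ?gt_eqF// div1r.
  have lnab : b^-1 <= ln b - ln a.
    have : ln (a / b) <= - b^-1.
      by rewrite ab; apply: le_ln1Dx; rewrite ltrN2 invf_lt1// ltr1n.
    by move=> hab; rewrite -lerN2 opprB -ln_div ?posrE.
  rewrite ler_pdivlMl// /powR !gt_eqF//.
  have -> : - p * ln b = - s * ln b - ln b by rewrite /s; ring.
  have -> : - s * ln a = - s * ln b + s * (ln b - ln a) by ring.
  rewrite !expRD expRN lnK ?posrE//.
  have : 1 + s / b <= expR (s * (ln b - ln a)).
    by apply: le_trans (expR_ge1Dx _); rewrite lerD2l ler_wpM2l// ltW.
  have := expR_gt0 (- s * ln b); set e := expR _; set d := expR _ => e0 hd.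
  by rewrite mulrCA -[X in _ <= _ - X]mulr1 -mulrBr ler_pM2l// lerBrDl.
have claim n : \sum_(k < n.+2) k%:R `^ (- p) <= 1 + s^-1 * (1 - n.+1%:R `^ (- s)).
  elim: n => [|n ih].
    rewrite !big_ord_recr big_ord0/= powR0 ?oppr_eq0 ?gt_eqF ?(lt_trans ltr01)//.
    by rewrite !powR1 subrr mulr0 add0r addr0.
  rewrite big_ord_recr/=; have := step n.+1 isT; move: ih.
  set S := \sum_(_ < _) _; set u := n.+1%:R `^ _; set v := n.+2%:R `^ (- s).
  by rewrite !mulrBr; lra.
exists (1 + s^-1) => n.
apply: (@le_trans _ _ (\sum_(k < n.+2) k%:R `^ (- p))).
  by rewrite !big_ord_recr/= -addrA lerDl addr_ge0// powR_ge0.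
apply: (le_trans (claim n)); rewrite lerD2l ler_piMr//.
by rewrite invr_ge0 ltW.
Qed.

Lemma powR_expR_le a b C eps : 0 < b -> 0 < eps ->
  \forall k \near \oo, C * (k%:R `^ a * expR (- (b * k%:R))) <= eps.
Proof.
move=> b0 eps0.
have [q aq] : exists q : nat, `|a| < q%:R.
  by exists (Num.truncn `|a|).+1; exact: truncnS_gt.
pose D := `|C| * (q.+1`!%:R / b ^+ q.+1).
near=> k.
have k1 : 1 <= k%:R :> R by near: k; exact: near_natr_ge.
have k0 : 0 < k%:R :> R by exact: lt_le_trans k1.
have kD : D / eps <= k%:R by near: k; exact: near_natr_ge.
have D0 : 0 <= D by rewrite mulr_ge0// divr_ge0// exprn_ge0// ltW.
have E0 := expR_gt0 (b * k%:R).
have hexp : (b * k%:R) ^+ q.+1 / q.+1`!%:R <= expR (b * k%:R).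
  have bk0 : 0 <= b * k%:R by rewrite mulr_ge0// ltW.
  by have := expR_ge1Dxn q bk0; lra.
have ka : k%:R `^ a <= k%:R ^+ q :> R.
  rewrite -powR_mulrn; last exact: ltW.
  by apply: ler_powR => //; rewrite (le_trans (ler_norm a))// ltW.
have X0 : 0 <= k%:R `^ a * expR (- (b * k%:R)).
  by rewrite mulr_ge0 ?powR_ge0 ?expR_ge0.
apply: (le_trans (ler_wpM2r X0 (ler_norm C))).
rewrite expRN mulrA ler_pdivrMr//.
set w := b ^+ q.+1 / q.+1`!%:R.
have w0 : 0 < w by rewrite divr_gt0 ?exprn_gt0// ltr0n fact_gt0.
have CD : `|C| = D * w.
  have fq : q.+1`!%:R != 0 :> R by rewrite pnatr_eq0 -lt0n fact_gt0.
  rewrite /D /w -mulrA.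
  by field; rewrite ?fq ?gt_eqF ?exprn_gt0.
apply: (@le_trans _ _ (D * w * k%:R ^+ q)).
  by rewrite CD ler_wpM2l// mulr_ge0// ltW.
apply: (@le_trans _ _ (eps * k%:R * w * k%:R ^+ q)).
  apply: ler_wpM2r; first by rewrite exprn_ge0// ltW.
  apply: ler_wpM2r; first exact: ltW.
  by rewrite mulrC -ler_pdivrMr.
rewrite -!mulrA ler_wpM2l ?(ltW eps0)// (le_trans _ hexp)// /w.
rewrite exprMn [k%:R ^+ q.+1]exprS le_eqVlt; apply/orP; left; apply/eqP. ring.
Unshelve. all: by end_near. Qed.

Lemma near_powR_ge a C : 0 < a -> \forall k \near \oo, C <= k%:R `^ a.
Proof.
move=> a0; near=> k.
have [C0|C0] := leP C 0; first exact: le_trans C0 (powR_ge0 _ _).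
have -> : C = (C `^ a^-1) `^ a by rewrite -powRrM mulVf ?gt_eqF// powRr1// ltW.
apply: ge0_ler_powR; rewrite ?nnegrE ?powR_ge0 ?(ltW a0)//.
near: k; exact: near_natr_ge.
Unshelve. all: by end_near. Qed.

Lemma near_ln_ge b C : 0 < b -> \forall k \near \oo, C <= ln (b * k%:R).
Proof.
move=> b0; near=> k.
have h : expR C <= b * k%:R.
  by rewrite -ler_pdivrMl//; near: k; exact: near_natr_ge.
by rewrite -[C]expRK ler_ln ?posrE ?expR_gt0// (lt_le_trans (expR_gt0 C)).
Unshelve. all: by end_near. Qed.
End asymptotics.

(** * Absence of returns along exponentially growing times *)

Section epochs.
Context {R : realType}.
Implicit Types (tau K b delta : R) (k : nat).

Definition epoch tau k : nat := Num.truncn (expR (tau * k%:R)).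
(** With K = 2 tau / c0 the decorrelation error after the lag is of the order of
    the inverse square of the epoch. *)
Definition lag K k : nat := (Num.truncn (K * k%:R)).+1.

Lemma epoch_le tau k : (epoch tau k)%:R <= expR (tau * k%:R).
Proof. by rewrite truncn_le expR_ge0. Qed.

Lemma lag_ge K k : K * k%:R <= (lag K k)%:R.
Proof. by rewrite ltW// truncnS_gt. Qed.

Lemma lag_le K k : 0 <= K -> (0 < k)%N -> (lag K k)%:R <= (K + 1) * k%:R.
Proof.
move=> K0 k0; rewrite /lag -natr1 mulrDl mul1r lerD//.
  by rewrite truncn_le mulr_ge0.
by rewrite ler1n.
Qed.

Lemma near_negligible a b C : 0 < b ->
  \forall k \near \oo, C * (k%:R `^ a * expR (- (b * k%:R))) <= k%:R `^ (- 2) / 4.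
Proof.
move=> b0; near=> k.
have k1 : 1 <= k%:R :> R by near: k; exact: near_natr_ge.
have k0 : 0 < k%:R :> R by exact: lt_le_trans k1.
have h : C * (k%:R `^ (a + 2) * expR (- (b * k%:R))) <= 4^-1.
  by near: k; apply: powR_expR_le.
have -> : k%:R `^ a = k%:R `^ (- 2) * k%:R `^ (a + 2).
  by rewrite -powRD ?(gt_eqF k0) ?implybT//; congr powR; ring.
rewrite -mulrA mulrCA ler_wpM2l// powR_ge0.
Unshelve. all: by end_near. Qed.

Lemma bounded_sums_expRN C (c : R) : 0 < c ->
  bounded_sums (fun k => C * expR (- (c * k%:R))).
Proof.
move=> c0; apply: (@bounded_sums_near _ _ (fun k => k%:R `^ (- 2))).
- by move=> k; exact: powR_ge0.
- near=> k.
  have h : C * (k%:R `^ 0 * expR (- (c * k%:R))) <= k%:R `^ (- 2) / 4.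
    by near: k; exact: near_negligible.
  move: h; rewrite powRr0 mul1r => /le_trans; apply.
  by rewrite ler_piMr ?powR_ge0// invf_le1// ler1n.
- by apply: bounded_sums_powRN; rewrite ltr1n.
Unshelve. all: by end_near. Qed.

(** The rounding of the exponential and the linear lag are both negligible. *)
Lemma near_epoch_lag tau K delta : 0 < tau -> 0 <= K -> 0 < delta ->
  \forall k \near \oo,
    (1 - delta) * expR (tau * k%:R) <= (epoch tau k - (lag K k).*2)%:R.
Proof.
move=> tau0 K0 delta0; near=> k.
have k1 : 1 <= k%:R :> R by near: k; exact: near_natr_ge.
have h : (2 * (K + 1) + 1) * (k%:R `^ 1 * expR (- (tau * k%:R))) <= delta.
  by near: k; apply: powR_expR_le.
have E0 := expR_gt0 (tau * k%:R).
have lagk : (lag K k)%:R <= (K + 1) * k%:R.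
  by apply: lag_le => //; rewrite -(ltr0n R) (lt_le_trans _ k1).
have epk : expR (tau * k%:R) < (epoch tau k)%:R + 1.
  by rewrite natr1 truncnS_gt.
have : (epoch tau k)%:R - (lag K k).*2%:R <= (epoch tau k - (lag K k).*2)%:R :> R.
  have [le|lt] := leqP (lag K k).*2 (epoch tau k); first by rewrite natrB.
  by rewrite (@le_trans _ _ 0)// subr_le0 ler_nat ltnW.
apply: le_trans.
move: h; rewrite powRr1 ?(le_trans ler01 k1)// expRN mulrA ler_pdivrMr//.
by rewrite -addnn natrD; move: (expR _) E0 epk lagk => E E0 epk lagk; nra.
Unshelve. all: by end_near. Qed.
End epochs.

Section no_return_epochs.
Context {R : realType} (mu : probability R R) (F : R -> R).
Hypothesis mF : measurable_fun setT F.
Hypothesis invF :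
  forall A : set R, measurable A -> pr mu (F @^-1` A) = pr mu A.
Variables C0 c0 : R.
Hypothesis C0_ge0 : 0 <= C0.
Hypothesis c0_gt0 : 0 < c0.
Hypothesis mixF : forall (a b : R) j (A : set R), measurable A ->
  `|pr mu (`[a, b[ `&` iter j F @^-1` A) - pr mu `[a, b[ * pr mu A| <=
  C0 * expR (- (c0 * j%:R)) * pr mu A.
Variables beta C : R.
Hypothesis beta_gt0 : 0 < beta.
Hypothesis C_ge0 : 0 <= C.
Hypothesis shortF : forall n j : nat, (1 <= n)%N -> (1 <= j)%N ->
  j%:R <= (ln n%:R : R) ^+ 2 ->
  pr mu (return_set F j (n%:R `^ (- 2^-1))) <= C * n%:R `^ (- beta).
Variables (X : set R) (lam : {measure set R -> \bar R}) (rho : R -> R) (M : R).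
Hypothesis itvX : is_interval X.
Hypothesis M_ge0 : 0 <= M.
Hypothesis massM : forall a b : R, a <= b -> pr mu `[a, b[ <= M * (b - a).
Hypothesis mrho : measurable_fun X rho.
Hypothesis rho_ge0 : forall x, X x -> 0 <= rho x.
Hypothesis density : forall A : set R, measurable A -> A `<=` X ->
  mu A = (\int[lam]_(x in A) (rho x)%:E)%E.

(** The bound on short returns is available at radius n^(-1/2) for the epoch n,
    which is much larger than the radii considered here. *)
Lemma near_early_returns (tau p K : R) (u : nat -> R) : 0 < tau -> 0 <= K ->
  (\forall k \near \oo, 1 <= u k <= k%:R `^ p) ->
  \forall k \near \oo, forall j : nat, (1 <= j < lag K k)%N ->
    pr mu (return_set F j (2 * (u k / expR (tau * k.+1%:R)))) <=
    C * ((2 : R) `^ beta * expR (- (beta * tau * k%:R))).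
Proof.
move=> tau0 K0 hu; near=> k => j /andP[j1 jt].
have k1 : 1 <= k%:R :> R by near: k; exact: near_natr_ge.
have /andP[u1 up] : 1 <= u k <= k%:R `^ p by near: k.
have k0 : (0 < k)%N by rewrite -(ltr0n R) (lt_le_trans _ k1).
set E := expR (tau * k%:R); have E0 : 0 < E by exact: expR_gt0.
have NE : (epoch tau k)%:R <= E by exact: epoch_le.
have EN : E / 2 <= (epoch tau k)%:R.
  have h : (1 - 2^-1) * expR (tau * k%:R) <= (epoch tau k - (lag K k).*2)%:R.
    by near: k; exact: near_epoch_lag.
  apply: (@le_trans _ _ (epoch tau k - (lag K k).*2)%:R).
    by move: h; rewrite -/E; lra.
  by rewrite ler_nat leq_subr.
set N := epoch tau k in NE EN *.
have N0 : 0 < N%:R :> R by rewrite (lt_le_trans _ EN)// divr_gt0.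
have N1 : (1 <= N)%N by rewrite -(ltr0n R).
apply: (@le_trans _ _ (pr mu (return_set F j (N%:R `^ (- 2^-1))))).
  apply: pr_le; [exact: measurable_return_set..|].
  move=> x; rewrite /return_set/= => /le_trans; apply.
  have h : 2 * (k%:R `^ p * expR (- (tau / 2 * k%:R))) <= 1.
    by near: k; apply: powR_expR_le => //; rewrite divr_gt0.
  apply: (@le_trans _ _ (2 * (k%:R `^ p / E))).
    rewrite ler_wpM2l// ler_pM ?invr_ge0 ?expR_ge0 ?(le_trans ler01 u1)//.
    rewrite lef_pV2 ?posrE ?expR_gt0// ler_expR ler_wpM2l ?(ltW tau0)//.
    by rewrite ler_nat.
  apply: (@le_trans _ _ (expR (- (tau / 2 * k%:R)))).
    have -> : E^-1 = expR (- (tau / 2 * k%:R)) * expR (- (tau / 2 * k%:R)).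
      by rewrite -expRD -expRN; congr expR; field.
    by rewrite 2!mulrA -[leRHS]mul1r ler_wpM2r ?expR_ge0// -mulrA.
  have -> : expR (- (tau / 2 * k%:R)) = E `^ (- 2^-1).
    by rewrite /powR gt_eqF// /E expRK; congr expR; field.
  rewrite !powRN lef_pV2 ?posrE ?powR_gt0//.
  by apply: ge0_ler_powR; rewrite ?nnegrE ?(ltW N0) ?(ltW E0)//.
apply: (le_trans (shortF N1 j1 _)).
  have lnN : tau * k%:R / 2 <= ln N%:R.
    apply: (@le_trans _ _ (ln (E / 2))); last first.
      by rewrite ler_ln ?posrE// divr_gt0.
    rewrite ln_div ?posrE// /E expRK.
    have : 2 * ln 2 / tau <= k%:R by near: k; exact: near_natr_ge.
    by rewrite ler_pdivrMr//; lra.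
  apply: (@le_trans _ _ ((K + 1) * k%:R)).
    by rewrite (le_trans _ (lag_le K0 k0))// ler_nat ltnW.
  apply: (@le_trans _ _ ((tau * k%:R / 2) ^+ 2)).
    have : (K + 1) * 4 / tau ^+ 2 <= k%:R by near: k; exact: near_natr_ge.
    rewrite ler_pdivrMr ?exprn_gt0// => h.
    have -> : (tau * k%:R / 2) ^+ 2 = k%:R * tau ^+ 2 / 4 * k%:R by field.
    by rewrite ler_wpM2r// ler_pdivlMr.
  by rewrite ler_pXn2r// nnegrE ?(le_trans _ lnN)// divr_ge0// mulr_ge0// ltW.
rewrite ler_wpM2l//.
have -> : (2 : R) `^ beta * expR (- (beta * tau * k%:R)) = (E / 2) `^ (- beta).
  rewrite /powR !gt_eqF ?divr_gt0// ln_div ?posrE// /E expRK -expRD.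
  by congr expR; ring.
rewrite !powRN lef_pV2 ?posrE ?powR_gt0 ?divr_gt0//.
by apply: ge0_ler_powR;
  rewrite ?nnegrE ?(ltW beta_gt0) ?(ltW N0) ?divr_ge0 ?(ltW E0)//.
Unshelve. all: by end_near. Qed.

(** The estimate at scale expR (tau * k): the errors are exponentially small
    in k up to powers of k, which leaves the two terms that depend on the
    density. *)
Lemma near_pr_no_return (tau p : R) (u : nat -> R) (m : nat) : 0 < tau ->
  (\forall k \near \oo, 1 <= u k <= k%:R `^ p) ->
  let K := 2 * tau / c0 in
  let r k := u k / expR (tau * k.+1%:R) in
  let h k := r k / m.+1%:R in
  \forall k \near \oo, forall (g : R -> R) (theta S : R),
    measurable_fun X g ->
    (forall a b x : R, `[a, b[ `<=` X -> a <= x < b ->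
       b - a <= 2 * r k -> g x * (b - a) <= pr mu `[a, b[) ->
    k%:R `^ (- p) <= theta -> 0 <= S ->
    (\int[lam]_(x in X) (rho x * expR (-
       ((epoch tau k - (lag K k).*2)%:R * (m.*2.+1)%:R * h k * g x)))%:E <=
     S%:E)%E ->
    pr mu (X `&` no_return F (epoch tau k) (r k)) <=
      k%:R `^ (- 2) + pr mu (X `&` [set x | g x < theta]) + expR 1 * S.
Proof.
move=> tau0 hu K r h.
have K0 : 0 <= K by rewrite /K divr_ge0 ?mulr_ge0 ?ltW.
near=> k => g theta S mg g_mass htheta S0 intS.
have k1 : 1 <= k%:R :> R by near: k; exact: near_natr_ge.
have /andP[u1 up] : 1 <= u k <= k%:R `^ p by near: k.
have kp : 0 < k%:R :> R by exact: lt_le_trans k1.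
have k0 : (0 < k)%N by rewrite -(ltr0n R).
have NtE : (1 - 2^-1) * expR (tau * k%:R) <= (epoch tau k - (lag K k).*2)%:R.
  by near: k; exact: near_epoch_lag.
have early : forall j : nat, (1 <= j < lag K k)%N ->
    pr mu (return_set F j (2 * (u k / expR (tau * k.+1%:R)))) <=
    C * ((2 : R) `^ beta * expR (- (beta * tau * k%:R))).
  by near: k; exact: (near_early_returns tau0 K0 hu).
set E := expR (tau * k%:R) in NtE *; have E0 : 0 < E by exact: expR_gt0.
have EV : E^-1 = expR (- (tau * k%:R)) by rewrite expRN.
set N := epoch tau k in intS NtE *; set t := lag K k in intS NtE early *.
have NE : N%:R <= E by exact: epoch_le.
have tN : (t.*2 <= N)%N.
  rewrite leqNgt; apply/negP => /ltnW; rewrite -subn_eq0 => /eqP Nt0.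
  by move: NtE; rewrite Nt0; nra.
have u0 : 0 < u k by exact: lt_le_trans u1.
have D0 := expR_gt0 (tau * k.+1%:R).
have r0 : 0 < r k by rewrite /r divr_gt0.
have h0 : 0 < h k by rewrite /h divr_gt0.
have mh : m.+1%:R * h k = r k by rewrite /h mulrC divfK// pnatr_eq0.
have mh2 : m.+1.*2%:R * h k = 2 * r k by rewrite -mh -addnn natrD; ring.
have kpp : 0 < k%:R `^ p by exact: powR_gt0.
have theta0 : 0 < theta by rewrite (lt_le_trans _ htheta)// powR_gt0.
pose Theta j := C0 * expR (- (c0 * j%:R)).
have Theta0 j : 0 <= Theta j by rewrite mulr_ge0 ?expR_ge0.
have rE : r k <= u k / E.
  rewrite /r ler_wpM2l ?(ltW u0)// lef_pV2 ?posrE// ler_expR.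
  by rewrite ler_wpM2l ?(ltW tau0)// ler_nat.
have rkp : r k <= k%:R `^ p / E.
  by rewrite (le_trans rE)// ler_wpM2r// invr_ge0 ltW.
have ThetaE : Theta t <= C0 * (E^-1 * E^-1).
  rewrite /Theta ler_wpM2l// EV -expRD ler_expR -opprD lerN2.
  have := lag_ge K k; rewrite -/t /K => tK.
  have : c0 * (2 * tau / c0 * k%:R) <= c0 * t%:R by rewrite ler_wpM2l// ltW.
  have -> : c0 * (2 * tau / c0 * k%:R) = tau * k%:R + tau * k%:R.
    by field; rewrite gt_eqF.
  by [].
have g_mass' (a b x : R) : `[a, b[ `<=` X -> a <= x < b ->
    b - a <= 2 * (m.+1%:R * h k) -> g x * (b - a) <= pr mu `[a, b[.
  by rewrite mh; exact: g_mass.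
have := pr_no_return_le mF invF Theta0 mixF itvX M_ge0 massM mrho rho_ge0
  density mg h0 g_mass' (isT : (0 < t)%N) tN theta0 intS.
rewrite mh mh2 => /le_trans; apply.
have T1 : 8 * M * r k <= k%:R `^ (- 2) / 4.
  apply: (@le_trans _ _ (8 * M * (k%:R `^ p * expR (- (tau * k%:R))))).
    by rewrite -EV ler_wpM2l// mulr_ge0.
  by near: k; exact: near_negligible.
have T2 : expR (N%:R * Theta t) * S <= expR 1 * S.
  rewrite ler_wpM2r// ler_expR.
  apply: (@le_trans _ _ (E * (C0 * (E^-1 * E^-1)))).
    by rewrite ler_pM.
  have -> : E * (C0 * (E^-1 * E^-1)) = C0 * (k%:R `^ 0 * expR (- (tau * k%:R))).
    by rewrite powRr0 mul1r -EV; field; rewrite gt_eqF.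
  by near: k; exact: powR_expR_le.
have T3 : Theta t / (theta * h k) <= k%:R `^ (- 2) / 4.
  apply: (@le_trans _ _ (C0 * expR tau * m.+1%:R *
      (k%:R `^ p * expR (- (tau * k%:R))))); last first.
    by near: k; exact: near_negligible.
  have hh : (E * expR tau * m.+1%:R)^-1 <= h k.
    have EE : expR (tau * k.+1%:R) = E * expR tau.
      by rewrite -natr1 mulrDr mulr1 expRD.
    have -> : h k = u k * (E * expR tau * m.+1%:R)^-1.
      by rewrite /h /r EE [in RHS]invfM mulrA.
    by rewrite ler_peMl// invr_ge0 !mulr_ge0 ?expR_ge0.
  rewrite ler_pdivrMr; last exact: mulr_gt0.
  apply: (le_trans ThetaE).
  apply: (@le_trans _ _ (C0 * expR tau * m.+1%:R *
     (k%:R `^ p * expR (- (tau * k%:R))) *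
     (k%:R `^ (- p) * (E * expR tau * m.+1%:R)^-1))); last first.
    rewrite ler_wpM2l//.
      by rewrite !mulr_ge0 ?expR_ge0 ?powR_ge0.
    by rewrite ler_pM ?powR_ge0 ?invr_ge0 ?mulr_ge0 ?expR_ge0 ?(ltW E0).
  rewrite powRN -EV le_eqVlt; apply/orP; left; apply/eqP.
  by field; rewrite !gt_eqF ?expR_gt0 ?ltr0n//.
have T4 : M * h k * N%:R * m.*2.+1%:R *
    (\sum_(1 <= j < t) pr mu (return_set F j (2 * r k))) <= k%:R `^ (- 2) / 4.
  pose w := 2 `^ beta * expR (- (beta * tau * k%:R)) : R.
  have w0 : 0 <= w by rewrite mulr_ge0 ?expR_ge0 ?powR_ge0.
  have sumE : \sum_(1 <= j < t) pr mu (return_set F j (2 * r k)) <=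
      (K + 1) * k%:R * (C * w).
    apply: (@le_trans _ _ (\sum_(1 <= j < t) (C * w))).
      by apply: ler_sum_nat => j; exact: early.
    rewrite big_const_nat iter_addr addr0 -[leLHS]mulr_natl.
    rewrite ler_wpM2r ?mulr_ge0// (le_trans _ (lag_le K0 k0))// ler_nat -/t.
    by rewrite leq_subr.
  apply: (@le_trans _ _ (M * m.*2.+1%:R * (K + 1) * C * 2 `^ beta *
      (k%:R `^ (p + 1) * expR (- (beta * tau * k%:R))))); last first.
    by near: k; apply: near_negligible; rewrite mulr_gt0.
  have hN : h k * N%:R <= k%:R `^ p.
    apply: (@le_trans _ _ (r k * E)).
      rewrite ler_pM ?(ltW h0)//.
      by rewrite /h ler_piMr ?(ltW r0)// invf_le1// ler1n.
    by rewrite -ler_pdivlMr.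
  apply: (@le_trans _ _ (M * k%:R `^ p * m.*2.+1%:R * ((K + 1) * k%:R * (C * w)))).
    apply: ler_pM => //.
    - by rewrite !mulr_ge0// ltW.
    - by apply: sumr_ge0 => j _; exact: pr_ge0.
    - by rewrite ler_wpM2r// -mulrA ler_wpM2l.
  rewrite powRD ?(gt_eqF kp) ?implybT// powRr1 ?(ltW kp)// /w.
  by rewrite le_eqVlt; apply/orP; left; apply/eqP; ring.
have k20 : 0 <= k%:R `^ (- 2) :> R by exact: powR_ge0.
move: T1 T2 T3 T4 k20.
lra.
Unshelve. all: by end_near. Qed.
End no_return_epochs.

(** * Almost sure behaviour of the shortest return distance *)

Section min_return.
Context {R : realType}.
Implicit Types (F : R -> R) (n : nat) (x r : R).

Lemma bigmin_nat_le (x0 : R) (G : nat -> R) m n k : (m <= k < n)%N ->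
  \big[Num.min/x0]_(m <= i < n) G i <= G k.
Proof.
move=> /andP[mk kn]; apply: (le_trans (le_bigmin_nat xpredT G mk kn)).
by rewrite big_ltn// big_geq// ge_min lexx.
Qed.

Lemma min_return_le F n k x : (1 <= k <= n)%N ->
  min_return F n x <= `|x - iter k F x|.
Proof.
by move=> kn; rewrite distrC; apply: bigmin_nat_le; rewrite ltnS.
Qed.

Lemma lt_min_return F n x r : (0 < n)%N -> no_return F n r x ->
  r < min_return F n x.
Proof.
move=> n0 nr; rewrite /min_return big_nat; apply: lt_bigmin.
  by have := nr 1 n0; rewrite distrC.
by move=> k kn; rewrite distrC; exact: nr.
Qed.

Lemma measurable_min_return F n : measurable_fun setT F ->
  measurable_fun setT (min_return F n).
Proof.
move=> mF.
have mk k : measurable_fun setT (fun x : R => `|iter k F x - x|).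
  apply: measurableT_comp => //; apply: measurable_funB => //.
  exact: (measurable_iter mF k).
rewrite /min_return; elim: (index_iota 1 n.+1) => [|k s ih].
  by under eq_fun do rewrite big_nil; exact: (mk 1).
by under eq_fun do rewrite big_cons; exact: measurable_minr.
Qed.
End min_return.

Lemma measurable_eventually d (T : measurableType d) (A : nat -> set T) :
  (forall n, measurable (A n)) ->
  measurable [set x | \forall n \near \oo, A n x].
Proof.
move=> mA.
have -> : [set x | \forall n \near \oo, A n x] =
    \bigcup_N \bigcap_(n in [set n | (N <= n)%N]) A n.
  apply/seteqP; split=> x.
    by move=> [N _ h]; exists N => // n; exact: h.
  by move=> [N _ h]; exists N => // n; exact: h.
apply: bigcupT_measurable => N; exact: bigcap_measurableType.
Qed.

Section eventual_returns.
Context {R : realType} (mu : probability R R) (F : R -> R).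
Hypothesis mF : measurable_fun setT F.
Variable X : set R.
Hypothesis mX : measurable X.

(** The smallest distance is monotone in n, so it suffices to control it at
    the times [epoch tau k]. *)
Lemma eventually_min_return_lt (tau : R) (v r : nat -> R) : 0 < tau ->
  bounded_sums (fun k => pr mu (X `&` no_return F (epoch tau k) (v k))) ->
  (\forall k \near \oo, forall n : nat,
     expR (tau * k%:R) <= n%:R < expR (tau * k.+1%:R) -> v k < r n) ->
  exists Z : set R, [/\ measurable Z, mu Z = 0%E &
    forall x, X x -> ~ Z x -> \forall n \near \oo, min_return F n x < r n].
Proof.
move=> tau0 sumv [K1 _ vr].
have mA k : measurable (X `&` no_return F (epoch tau k) (v k)).
  by apply: measurableI => //; exact: measurable_no_return.
have [Z [mZ Z0 hZ]] := pr_borel_cantelli mu mA sumv.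
exists Z; split=> // x Xx /hZ[K2 _ hK].
pose K := maxn K1 K2.
exists (Num.truncn (expR (tau * K%:R))).+1 => // n /=.
rewrite -(ler_nat R) => Kn.
have KE : expR (tau * K%:R) <= n%:R by rewrite (le_trans _ Kn)// ltW// truncnS_gt.
have n0 : 0 < n%:R :> R by rewrite (lt_le_trans (expR_gt0 _) KE).
have Kln : K%:R <= ln n%:R / tau.
  by rewrite ler_pdivlMr// -ler_expR lnK ?posrE// mulrC.
have q0 : 0 <= ln n%:R / tau by rewrite (le_trans _ Kln).
have := truncn_itv q0; set k := Num.truncn _.
rewrite ler_pdivlMr// ltr_pdivrMr// => /andP[k1 k2].
have Kk : (K <= k)%N by rewrite /k truncn_ge_nat.
have kn : expR (tau * k%:R) <= n%:R < expR (tau * k.+1%:R).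
  rewrite -{1 2}(lnK (n0 : n%:R \is Num.pos)) ler_expR ltr_expR.
  by rewrite ![tau * _]mulrC k1 k2.
have vkn : v k < r n.
  by apply: vr => //=; rewrite (leq_trans _ Kk)// leq_maxl.
apply: le_lt_trans vkn; rewrite leNgt; apply/negP => vmin.
apply: (hK k); first by rewrite /= (leq_trans _ Kk)// leq_maxr.
split=> // j /andP[j1 jn]; apply: (lt_le_trans vmin).
apply: min_return_le; rewrite j1/= (leq_trans jn)//.
rewrite -(ler_nat R) (le_trans (epoch_le _ _))//.
by case/andP: kn.
Qed.

Variables (Theta : nat -> R).
Hypothesis X1 : mu X = 1%E.
Hypothesis Theta_ge0 : forall j, 0 <= Theta j.
Hypothesis mixF : forall (a b : R) j (A : set R), measurable A ->
  `|pr mu (`[a, b[ `&` iter j F @^-1` A) - pr mu `[a, b[ * pr mu A| <=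
  Theta j * pr mu A.

(** Some cell of length delta has positive mass, and balls of radius delta around
    its points contain it. *)
Lemma ball_integral_gt0 delta : 0 < delta ->
  exists2 q : R, 0 < q & forall r, delta <= r ->
    (q%:E <= \int[mu]_(x in X) mu (X `&` ball x r))%E.
Proof.
move=> delta0.
have [b [i p0]] : exists b i, 0 < pr mu (cell b delta i).
  apply: contrapT => nobi.
  have : pr mu X <= 0.
    apply: (pr_runs delta0 mX) => b N.
    have <- : \sum_(i < N) pr mu (cell b delta i) = 0.
      apply: big1 => i _; apply/eqP; rewrite eq_le pr_ge0 andbT leNgt.
      by apply/negP => h; apply: nobi; exists b, i.
    apply: (pr_cover mu (A := cell b delta)).
    - exact: measurable_cell.
    - by apply: measurableI => //; exact: measurable_itv.
    - by move=> x [_]; rewrite /= in_itv/=; exact: cell_cover.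
  by rewrite /pr X1/= ler10.
exists (pr mu (cell b delta i) ^+ 2); first exact: exprn_gt0.
move=> r deltar.
apply: (@le_trans _ _ (\int[mu]_(x in X) mu (X `&` ball x delta))%E).
  apply: le_trans (sum_sqr_cell_le b i.+1 delta0 mX X1).
  rewrite lee_fin big_ord_recr/= lerDr; apply: sumr_ge0 => j _.
  exact: sqr_ge0.
have mb e : measurable_fun X (fun x => mu (X `&` ball x e)).
  by apply: measurable_funTS; exact: measurable_pr_ball.
have mXb x e : measurable (X `&` ball x e).
  by apply: measurableI => //; exact: measurable_ball.
apply: ge0_le_integral => // x Xx; apply: le_measure; rewrite ?inE//.
by apply: setIS; exact: le_ball.
Qed.

(** Late returns are excluded by summability and the monotonicity of r.  For the
    finitely many early return times, almost every displacement is positive,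
    whereas summability of Q forces r below every positive number. *)
Lemma eventually_lt_min_return (r Q : nat -> R) :
  (forall m n : nat, (1 <= m)%N -> (m <= n)%N -> r n <= r m) ->
  (forall n, 0 <= Q n) ->
  (forall n, (1 <= n)%N ->
    \int[mu]_(x in X) mu (X `&` ball x (r n)) <= (Q n)%:E)%E ->
  bounded_sums Theta -> bounded_sums Q ->
  (forall k, (0 < k)%N -> mu (return_set F k 0) = 0%E) ->
  exists Z : set R, [/\ measurable Z, mu Z = 0%E &
    forall x, X x -> ~ Z x -> \forall n \near \oo, r n < min_return F n x].
Proof.
move=> rmono Q0 hQ sumT sumQ aperiodic.
have mE k e : measurable (return_set F k e) by exact: measurable_return_set.
have sumE : bounded_sums (fun k => pr mu (return_set F k (r k))).
  apply: (@bounded_sums_near _ _ (fun k => 3 * Q k + 3 * Theta k)).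
  - by move=> k; rewrite addr_ge0// mulr_ge0.
  - exists 1%N => // k /= k1; have [rk|rk] := ltP 0 (r k).
      exact: pr_return_set_le (hQ k k1).
    apply: (@le_trans _ _ (pr mu (return_set F k 0))).
      by apply: pr_le => // x; rewrite /return_set/= => /le_trans; exact.
    by rewrite /pr aperiodic//= addr_ge0// mulr_ge0.
  - by apply: bounded_sumsD; apply: bounded_sumsZ.
have [Z [mZ Z0 hZ]] := pr_borel_cantelli mu (fun k => mE k (r k)) sumE.
pose Z' := \bigcup_k return_set F k.+1 0.
have mZ' : measurable Z' by apply: bigcupT_measurable => k.
have Z'0 : mu Z' = 0%E.
  apply: measure_negligible => //; apply: negligible_bigcup => k.
  by apply/negligibleP; [exact: mE|exact: aperiodic].
exists (Z `|` Z'); split; first exact: measurableU.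
  apply: measure_negligible; first exact: measurableU.
  by apply: negligibleU; apply/negligibleP.
move=> x Xx /not_orP[/hZ[K _ hK] nZ'].
have disp k : (0 < k)%N -> 0 < `|x - iter k F x|.
  move=> k0; rewrite lt_neqAle normr_ge0 andbT eq_sym; apply/negP => /eqP d0.
  apply: nZ'; exists k.-1 => //; rewrite /return_set/= -iterS prednK//.
  by rewrite d0.
(* The shortest displacement before time K. *)
pose delta : R := \big[Num.min/1]_(1 <= k < K) `|x - iter k F x|.
have delta0 : 0 < delta.
  by rewrite /delta big_nat; apply: lt_bigmin => // k /andP[k0 _]; exact: disp.
have [N N1 rN] : exists2 N, (1 <= N)%N & r N < delta.
  apply: contrapT => noN.
  have [q q0 hq] := ball_integral_gt0 delta0.
  have [S hS] := sumQ.
  have qQ n : (1 <= n)%N -> q <= Q n.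
    move=> n1; rewrite -lee_fin (le_trans _ (hQ n n1))// hq// leNgt.
    by apply/negP => h; apply: noN; exists n.
  have := truncnS_gt (S / q); set n := (Num.truncn _).+1.
  rewrite ltr_pdivrMr// ltNge => /negP; apply.
  apply: (le_trans _ (hS n.+1)); rewrite big_ord_recl/=.
  rewrite -[leLHS]add0r lerD// mulr_natl -[in leLHS](card_ord n) -sumr_const.
  by apply: ler_sum => k _; exact: qQ.
exists (maxn N (maxn K 1)) => // n /=; rewrite !geq_max => /and3P[Nn Kn n1].
apply: lt_min_return => // k /andP[k1 kn].
have [kK|Kk] := ltnP k K; last first.
  rewrite (le_lt_trans (rmono _ _ k1 kn))// ltNge; apply/negP => h.
  exact: (hK k).
apply: (le_lt_trans (rmono _ _ N1 Nn)); apply: (lt_le_trans rN).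
by apply: bigmin_nat_le; rewrite k1.
Qed.
End eventual_returns.

(** * The two conditions on the density *)

Section upper_bounds.
Context {R : realType} (mu : probability R R) (F : R -> R).
Hypothesis mF : measurable_fun setT F.
Hypothesis invF :
  forall A : set R, measurable A -> pr mu (F @^-1` A) = pr mu A.
Variables C0 c0 : R.
Hypothesis C0_ge0 : 0 <= C0.
Hypothesis c0_gt0 : 0 < c0.
Hypothesis mixF : forall (a b : R) j (A : set R), measurable A ->
  `|pr mu (`[a, b[ `&` iter j F @^-1` A) - pr mu `[a, b[ * pr mu A| <=
  C0 * expR (- (c0 * j%:R)) * pr mu A.
Variables beta C : R.
Hypothesis beta_gt0 : 0 < beta.
Hypothesis C_ge0 : 0 <= C.
Hypothesis shortF : forall n j : nat, (1 <= n)%N -> (1 <= j)%N ->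
  j%:R <= (ln n%:R : R) ^+ 2 ->
  pr mu (return_set F j (n%:R `^ (- 2^-1))) <= C * n%:R `^ (- beta).
Variables (X : set R) (lam : {measure set R -> \bar R}) (rho : R -> R) (M : R).
Hypothesis itvX : is_interval X.
Hypothesis X1 : mu X = 1%E.
Hypothesis lam_itv : forall a b : R, a <= b ->
  lam `[a, b[%classic = (b - a)%:E.
Hypothesis mrho : measurable_fun X rho.
Hypothesis rho_ge0 : forall x, X x -> 0 <= rho x.
Hypothesis M_ge0 : 0 <= M.
Hypothesis rho_le : forall x, X x -> rho x <= M.
Hypothesis density : forall A : set R, measurable A -> A `<=` X ->
  mu A = (\int[lam]_(x in A) (rho x)%:E)%E.

Let mX : measurable X. Proof. exact: (is_interval_measurable itvX). Qed.

Lemma mass_le (a b : R) : a <= b -> pr mu `[a, b[ <= M * (b - a).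
Proof.
move=> ab.
have mab : measurable (`[a, b[%classic : set R) by exact: measurable_itv.
have mXab : measurable (X `&` `[a, b[) by exact: measurableI.
rewrite -(pr_full mu mX X1 mab) -lee_fin -(prE mu mXab).
rewrite density//.
apply: (@le_trans _ _ (\int[lam]_(x in X `&` `[a, b[) M%:E)%E).
  apply: ge0_le_integral => //.
  - by move=> x [Xx _]; rewrite lee_fin rho_ge0.
  - by apply/measurable_EFinP; apply: measurable_funS mrho => // x [].
  - by move=> x [Xx _]; rewrite lee_fin rho_le.
rewrite integral_cst// EFinM -(lam_itv ab); apply: lee_wpmul2l => //.
by apply: le_measure; rewrite ?inE//; exact: subIsetr.
Qed.

Lemma mass_ge (a b c : R) : a <= b -> `[a, b[ `<=` X ->
  (forall y, a <= y < b -> c <= rho y) -> c * (b - a) <= pr mu `[a, b[.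
Proof.
move=> ab abX crho.
have [c0'|cneg] := ltP 0 c; last first.
  by apply: le_trans (pr_ge0 _ _); rewrite mulr_le0_ge0 ?subr_ge0.
have mab : measurable (`[a, b[%classic : set R) by exact: measurable_itv.
rewrite -lee_fin -(prE mu mab) density// EFinM -(lam_itv ab) -integral_cst//.
apply: ge0_le_integral => //.
- by move=> x _; rewrite lee_fin ltW.
- by apply/measurable_EFinP; exact: measurable_funS mrho.
Qed.

Lemma integral_rho : (\int[lam]_(x in X) (rho x)%:E = 1)%E.
Proof. by rewrite -density. Qed.

(** With u k = c ln (eta k) the density term is at most a multiple of a power of k
    whose exponent is close to - 2 c m0, hence less than - 1. *)
Lemma upper_of_pos_density (c m0 : R) (r : nat -> R) :
  0 < m0 -> (forall x, X x -> m0 <= rho x) -> 1 < 2 * c * m0 ->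
  (forall n : nat, (2 <= n)%N -> c * ln (ln n%:R) / n%:R < r n) ->
  exists Z : set R, [/\ measurable Z, mu Z = 0%E &
    forall x, X x -> ~ Z x -> \forall n \near \oo, min_return F n x < r n].
Proof.
move=> m00 m0rho cm0 hr.
have c0' : 0 < c by rewrite -(pmulr_lgt0 _ m00); lra.
set a0 := 2 * c * m0 in cm0.
have a00 : 0 < a0 by exact: lt_trans cm0.
(* A margin for three losses: the step tau between epochs, the lag, and the ratio
   of the length of the wide cells to 2 r.  Each costs a factor 1 - eta, and
   (1 - eta)^3 a0 still exceeds 1. *)
have [eta [eta0 eta1 eta3]] : exists eta : R,
    [/\ 0 < eta, eta < 1 & 1 - 3 * eta = a0^-1 + eta].
  have a0V : a0^-1 < 1 by rewrite invf_lt1.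
  have a0V0 : 0 < a0^-1 by rewrite invr_gt0.
  by exists ((1 - a0^-1) / 4); split; lra.
have [m hm] : exists m : nat, m.+1%:R^-1 <= eta.
  exists (Num.truncn eta^-1); rewrite -[leRHS]invrK lef_pV2 ?posrE ?invr_gt0//.
  by rewrite ltW// truncnS_gt.
pose u k := c * ln (eta * k%:R).
pose v k := u k / expR (eta * k.+1%:R).
pose sigma := (1 - eta) ^+ 3 * a0.
have sigma1 : 1 < sigma.
  have : 1 - 3 * eta <= (1 - eta) ^+ 3.
    have -> : (1 - eta) ^+ 3 = 1 - 3 * eta + eta ^+ 2 * (3 - eta) by ring.
    by rewrite lerDl mulr_ge0 ?sqr_ge0//; lra.
  rewrite eta3 => h; rewrite /sigma -ltr_pdivrMr// mul1r.
  by rewrite (lt_le_trans _ h)// ltrDl.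
have hu : \forall k \near \oo, 1 <= u k <= k%:R `^ 2.
  near=> k.
  have k1 : 1 <= k%:R :> R by near: k; exact: near_natr_ge.
  have k0 : 0 < k%:R :> R by exact: lt_le_trans k1.
  apply/andP; split.
    rewrite /u -ler_pdivrMl// mulr1; near: k; exact: near_ln_ge.
  have h1 : c * eta <= k%:R by near: k; exact: near_natr_ge.
  apply: (@le_trans _ _ (c * (eta * k%:R))).
    by rewrite /u ler_wpM2l ?(ltW c0')// ltW// ln_sublinear// mulr_gt0.
  by rewrite powR_mulrn// expr2 mulrA ler_wpM2r// ltW.
apply: (@eventually_min_return_lt _ _ _ mF X mX eta v r) => //; last first.
  near=> k => n /andP[kn nk].
  have lnk : 1 <= eta * k%:R.
    rewrite -ler_pdivrMl// mulr1; near: k; exact: near_natr_ge.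
  have n0 : 0 < n%:R :> R by rewrite (lt_le_trans (expR_gt0 _) kn).
  have n2 : (2 <= n)%N.
    rewrite -(ler_nat R) (le_trans _ kn)// (le_trans _ (expR_ge1Dx _))//.
    by rewrite -[2]/(1 + 1) lerD2l.
  apply: le_lt_trans (hr n n2).
  have lnn : eta * k%:R <= ln n%:R by rewrite -ler_expR lnK ?posrE.
  have u0 : 0 <= u k by rewrite mulr_ge0 ?ln_ge0 ?(ltW c0').
  rewrite /v ler_pM ?invr_ge0 ?expR_ge0//.
    rewrite /u ler_wpM2l ?(ltW c0')// ler_ln ?posrE//.
      by rewrite (lt_le_trans ltr01).
    by rewrite (lt_le_trans ltr01)// (le_trans lnk).
  by rewrite lef_pV2 ?posrE ?expR_gt0// ltW.
have bs : bounded_sums (fun k => k%:R `^ (- 2) +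
    expR 1 * eta `^ (- sigma) * k%:R `^ (- sigma)).
  apply: bounded_sumsD; first by apply: bounded_sums_powRN; rewrite ltr1n.
  apply: bounded_sumsZ; first by rewrite mulr_ge0 ?expR_ge0 ?powR_ge0.
  exact: bounded_sums_powRN.
pose K := 2 * eta / c0.
have K0 : 0 <= K.
  by apply: divr_ge0; [apply: mulr_ge0 => //; exact: ltW|exact: ltW].
apply: bounded_sums_near bs.
  by move=> k; rewrite addr_ge0 ?mulr_ge0 ?powR_ge0 ?expR_ge0.
near=> k.
have k1 : 1 <= k%:R :> R by near: k; exact: near_natr_ge.
have k0 : 0 < k%:R :> R by exact: lt_le_trans k1.
have /andP[u1 _] : 1 <= u k <= k%:R `^ 2 by near: k.
have ln0 : 0 <= ln (eta * k%:R).
  move: u1; rewrite /u -ler_pdivrMl// mulr1; apply: le_trans.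
  by rewrite invr_ge0 ltW.
have NtE : (1 - eta) * expR (eta * k%:R) <= (epoch eta k - (lag K k).*2)%:R.
  by near: k; exact: near_epoch_lag.
pose kap := (epoch eta k - (lag K k).*2)%:R * (m.*2.+1)%:R * (v k / m.+1%:R).
have main : forall (g : R -> R) (theta S : R),
    measurable_fun X g ->
    (forall a b x : R, `[a, b[ `<=` X -> a <= x < b ->
       b - a <= 2 * v k -> g x * (b - a) <= pr mu `[a, b[) ->
    k%:R `^ (- 2) <= theta -> 0 <= S ->
    (\int[lam]_(x in X) (rho x * expR (-
       ((epoch eta k - (lag K k).*2)%:R * (m.*2.+1)%:R * (v k / m.+1%:R) *
        g x)))%:E <=
     S%:E)%E ->
    pr mu (X `&` no_return F (epoch eta k) (v k)) <=
      k%:R `^ (- 2) + pr mu (X `&` [set x | g x < theta]) + expR 1 * S.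
  by near: k; exact: (near_pr_no_return mF invF C0_ge0 c0_gt0 mixF beta_gt0
    C_ge0 shortF itvX M_ge0 mass_le mrho rho_ge0 density m eta0 hu).
have := main (cst m0) m0 (expR (- (kap * m0))).
have -> : X `&` [set x | cst m0 x < m0] = set0.
  by apply/seteqP; split => x //= [_]; rewrite ltxx.
rewrite [pr mu set0]/pr measure0 addr0 => /(_ _ _ _ _ _)/le_trans; apply.
- exact: measurable_cst.
- move=> a b x abX /andP[ax xb] _; apply: mass_ge => //.
    by rewrite (le_trans ax)// ltW.
  by move=> y yab; apply: m0rho; apply: abX; rewrite /= in_itv.
- rewrite (le_trans _ (_ : m0 <= _))//.
  rewrite powRN invf_ple ?posrE ?powR_gt0// (le_trans _ (_ : k%:R <= _))//.
    near: k; exact: near_natr_ge.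
  by rewrite powR_mulrn ?(ltW k0)// expr2 ler_peMl// ltW.
- exact: expR_ge0.
- under eq_integral => x _ do rewrite /cst [rho x * _]mulrC EFinM.
  rewrite ge0_integralZl//; last exact/measurable_EFinP.
  by rewrite integral_rho mule1.
rewrite lerD2l -[leRHS]mulrA ler_wpM2l ?expR_ge0//.
rewrite -powRM ?(ltW k0) ?(ltW eta0)// /powR (gt_eqF (mulr_gt0 eta0 k0)) ler_expR.
rewrite mulNr lerN2.
have E0 := expR_gt0 (eta * k%:R).
have vE : v k = u k * expR (- eta) * (expR (eta * k%:R))^-1.
  by rewrite /v -natr1 mulrDr mulr1 expRD invfM expRN mulrA mulrAC.
have e1 : 1 - eta <= expR (- eta) by exact: expR_ge1Dx.
have mm : 2 * (1 - eta) <= (m.*2.+1)%:R / m.+1%:R.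
  have -> : (m.*2.+1)%:R = 2 * m.+1%:R - 1 :> R.
    by rewrite -addnn -!natr1 natrD; ring.
  rewrite mulrBl mulfK ?pnatr_eq0// mul1r.
  by move: hm; set q := m.+1%:R^-1 => hm; clearbody q; lra.
have kapE : kap = (epoch eta k - (lag K k).*2)%:R / expR (eta * k%:R) *
    ((m.*2.+1)%:R / m.+1%:R) * expR (- eta) * u k.
  by rewrite /kap vE; ring.
have h1 : 1 - eta <= (epoch eta k - (lag K k).*2)%:R / expR (eta * k%:R).
  by rewrite ler_pdivlMr.
have eta1' : 0 <= 1 - eta by rewrite subr_ge0 ltW.
have h2 : (1 - eta) * (2 * (1 - eta)) * (1 - eta) * u k <= kap.
  rewrite kapE ler_wpM2r ?(le_trans ler01 u1)//.
  by rewrite ler_pM ?mulr_ge0// ler_pM ?mulr_ge0.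
apply: (@le_trans _ _ ((1 - eta) * (2 * (1 - eta)) * (1 - eta) * u k * m0)).
  by rewrite /sigma /a0 /u le_eqVlt; apply/orP; left; apply/eqP; ring.
by rewrite ler_wpM2r// ltW.
Unshelve. all: by end_near. Qed.

(** On the set where the density is below 1/t the factor expR (1 - t rho)
    is at least 1. *)
Lemma pr_low_density (t I : R) : 0 < t ->
  (\int[lam]_(x in X) (rho x * expR (- (t * rho x)))%:E <= I%:E)%E ->
  pr mu (X `&` [set x | rho x < t^-1]) <= expR 1 * I.
Proof.
move=> t0 hI; set L := X `&` _.
have LX : L `<=` X by exact: subIsetl.
have mL : measurable L by exact: measurable_lt_cst.
have mphi : measurable_fun X (fun x => (rho x * expR (- (t * rho x)))%:E).
  apply/measurable_EFinP; apply: measurable_funM => //.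
  apply: measurableT_comp => //; apply: measurable_funN.
  exact: measurable_funM.
have phi0 x : X x -> (0 <= (rho x * expR (- (t * rho x)))%:E)%E.
  by move=> Xx; rewrite lee_fin mulr_ge0 ?expR_ge0 ?rho_ge0.
rewrite -lee_fin -(prE mu mL) density//.
apply: (@le_trans _ _ ((expR 1)%:E *
    \int[lam]_(x in X) (rho x * expR (- (t * rho x)))%:E)%E); last first.
  by rewrite EFinM lee_wpmul2l// lee_fin expR_ge0.
rewrite -ge0_integralZl//.
apply: (@le_trans _ _ (\int[lam]_(x in L)
    ((expR 1)%:E * (rho x * expR (- (t * rho x)))%:E))%E); last first.
  apply: ge0_subset_integral => //.
  - exact: measurable_funeM.
  - by move=> x Xx; rewrite mule_ge0 ?phi0// lee_fin expR_ge0.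
apply: ge0_le_integral => //.
- by move=> x [Xx _]; rewrite lee_fin rho_ge0.
- by apply/measurable_EFinP; apply: measurable_funS mrho => // x [].
- by apply: measurable_funeM; apply: measurable_funS mphi => // x [].
- move=> x [Xx /= lowx]; rewrite -EFinM lee_fin mulrCA -expRD.
  rewrite ler_peMr ?rho_ge0// -expR0 ler_expR subr_ge0.
  have : t * rho x <= t * t^-1 by apply: ler_wpM2l; exact: ltW.
  by rewrite expR0 divff ?gt_eqF.
Qed.

(** By Holder continuity the density minus a small D is a lower bound at the scale
    of the wide cells.  As gamma exceeds gamma0, the exponent is eventually
    larger than k^gamma0, and both the density term and the mass of the points
    of low density are dominated by I. *)
Lemma upper_of_holder_density (C1 alpha gamma0 gamma : R) (I r : nat -> R) :
  0 < C1 -> 0 < alpha ->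
  (forall x y, X x -> X y -> `|rho x - rho y| <= C1 * `|x - y| `^ alpha) ->
  gamma0 < gamma -> bounded_sums I ->
  (forall k, 0 <= I k) ->
  (forall k : nat, (1 <= k)%N ->
    \int[lam]_(x in X) (rho x * expR (- (k%:R `^ gamma0 * rho x)))%:E <=
    (I k)%:E)%E ->
  (forall n : nat, (1 <= n)%N -> ln n%:R `^ gamma / (2 * n%:R) < r n) ->
  exists Z : set R, [/\ measurable Z, mu Z = 0%E &
    forall x, X x -> ~ Z x -> \forall n \near \oo, min_return F n x < r n].
Proof.
move=> C10 alpha0 holder gg sumI I0 hI hr.
(* Otherwise the terms of the series would be bounded below by expR (- M). *)
have gamma0_gt0 : 0 < gamma0.
  rewrite ltNge; apply/negP => gamma0_le0.
  have IM k : (1 <= k)%N -> expR (- M) <= I k.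
    move=> k1; rewrite -lee_fin (le_trans _ (hI k k1))//.
    rewrite -[leLHS]mule1 -integral_rho -ge0_integralZl//; last first.
    - exact/measurable_EFinP.
    apply: ge0_le_integral => //.
    - move=> x Xx; rewrite -EFinM lee_fin mulr_ge0 ?expR_ge0 ?rho_ge0//.
    - by apply: measurable_funeM; exact/measurable_EFinP.
    - apply/measurable_EFinP; apply: measurable_funM => //.
      apply: measurableT_comp => //; apply: measurable_funN.
      exact: measurable_funM.
    - move=> x Xx; rewrite -EFinM lee_fin mulrC ler_wpM2l ?rho_ge0//.
      rewrite ler_expR lerN2 (le_trans _ (rho_le Xx))//.
      rewrite ler_piMl ?rho_ge0// -[leRHS](@powRr0 _ k%:R).
      by apply: ler_powR; rewrite // ler1n.
  have [S hS] := sumI.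
  have := truncnS_gt (S / expR (- M)); set n := (Num.truncn _).+1.
  rewrite ltr_pdivrMr ?expR_gt0// ltNge => /negP; apply.
  apply: (le_trans _ (hS n.+1)); rewrite big_ord_recl/=.
  rewrite -[leLHS]add0r lerD// mulr_natl -[in leLHS](card_ord n) -sumr_const.
  by apply: ler_sum => k _; exact: IM.
have gamma_gt0 : 0 < gamma by exact: lt_trans gg.
pose u (k : nat) : R := k%:R `^ gamma / 2.
pose v k := u k / expR ((1 : R) * k.+1%:R).
pose p := gamma + 1.
have hu : \forall k \near \oo, 1 <= u k <= k%:R `^ p.
  near=> k.
  have k1 : 1 <= k%:R :> R by near: k; exact: near_natr_ge.
  apply/andP; split.
    by rewrite ler_pdivlMr// mul1r; near: k; exact: near_powR_ge.
  apply: (@le_trans _ _ (k%:R `^ gamma)).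
    by rewrite ler_piMr ?powR_ge0// invf_le1// ler1n.
  by apply: ler_powR => //; rewrite lerDl.
apply: (@eventually_min_return_lt _ _ _ mF X mX 1 v r) => //; last first.
  near=> k => n /andP[kn nk].
  have k1 : 1 <= k%:R :> R by near: k; exact: near_natr_ge.
  have n0 : 0 < n%:R :> R by rewrite (lt_le_trans (expR_gt0 _) kn).
  have n1 : (1 <= n)%N by rewrite -(ltr0n R).
  apply: le_lt_trans (hr n n1).
  have lnn : k%:R <= ln n%:R :> R by rewrite -ler_expR lnK ?posrE// -[k%:R]mul1r.
  rewrite /v /u invfM mulrA ler_pM ?invr_ge0 ?expR_ge0 ?divr_ge0 ?powR_ge0//.
    rewrite ler_wpM2r ?invr_ge0//.
    apply: ge0_ler_powR; rewrite ?nnegrE ?(ltW gamma_gt0)//.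
    exact: le_trans lnn.
  by rewrite lef_pV2 ?posrE ?expR_gt0// ltW.
have bs : bounded_sums (fun k => k%:R `^ (- 2) +
    (expR 1 * I k + expR 1 * (expR 1 * I k))).
  apply: bounded_sumsD; first by apply: bounded_sums_powRN; rewrite ltr1n.
  by apply: bounded_sumsD; do ?apply: bounded_sumsZ => //; rewrite expR_ge0.
apply: bounded_sums_near bs.
  by move=> k; rewrite !addr_ge0 ?mulr_ge0 ?powR_ge0 ?expR_ge0.
pose K := 2 * 1 / c0.
have K0 : 0 <= K by rewrite /K divr_ge0// ltW.
near=> k.
have k1 : 1 <= k%:R :> R by near: k; exact: near_natr_ge.
have k0 : 0 < k%:R :> R by exact: lt_le_trans k1.
have kN : (1 <= k)%N by rewrite -(ltr0n R).
have /andP[u1 _] : 1 <= u k <= k%:R `^ p by near: k.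
have NtE : (1 - 2^-1) * expR ((1 : R) * k%:R) <=
    (epoch (1 : R) k - (lag K k).*2)%:R :> R.
  by near: k; exact: near_epoch_lag.
have main : forall (g : R -> R) (theta S : R),
    measurable_fun X g ->
    (forall a b x : R, `[a, b[ `<=` X -> a <= x < b ->
       b - a <= 2 * v k -> g x * (b - a) <= pr mu `[a, b[) ->
    k%:R `^ (- p) <= theta -> 0 <= S ->
    (\int[lam]_(x in X) (rho x * expR (-
       ((epoch (1 : R) k - (lag K k).*2)%:R * (0.*2.+1)%:R * (v k / 1%:R) *
        g x)))%:E <=
     S%:E)%E ->
    pr mu (X `&` no_return F (epoch (1 : R) k) (v k)) <=
      k%:R `^ (- 2) + pr mu (X `&` [set x | g x < theta]) + expR 1 * S.
  by near: k; exact: (near_pr_no_return mF invF C0_ge0 c0_gt0 mixF beta_gt0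
    C_ge0 shortF itvX M_ge0 mass_le mrho rho_ge0 density 0 ltr01 hu).
have kg : 4 * expR 1 <= k%:R `^ (gamma - gamma0).
  by near: k; apply: near_powR_ge; rewrite subr_gt0.
have kp2 : 2 <= k%:R `^ (p - gamma0).
  by near: k; apply: near_powR_ge; rewrite /p; lra.
have Dsmall : C1 * (k%:R `^ (gamma * alpha + gamma0) *
    expR (- (alpha * k%:R))) <= 2^-1.
  by near: k; exact: powR_expR_le.
have kapDsmall : C1 * (k%:R `^ (gamma + gamma * alpha) *
    expR (- (alpha * k%:R))) <= 1.
  by near: k; exact: powR_expR_le.
pose t : R := k%:R `^ gamma0; have t0 : 0 < t by exact: powR_gt0.
(* The exponent of the density term, and the modulus of continuity of the density
   at the scale of the wide cells. *)
pose kap : R := (epoch (1 : R) k - (lag K k).*2)%:R * (0.*2.+1)%:R * (v k / 1%:R).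
pose D : R := C1 * (2 * v k) `^ alpha.
have E0 := expR_gt0 (1 * k%:R).
have v0 : 0 < v k by rewrite /v divr_gt0 ?expR_gt0// (lt_le_trans _ u1).
have DE : D <= C1 * (k%:R `^ (gamma * alpha) * expR (- (alpha * k%:R))).
  rewrite /D ler_wpM2l ?(ltW C10)//.
  have -> : k%:R `^ (gamma * alpha) * expR (- (alpha * k%:R)) =
      (k%:R `^ gamma * expR (- k%:R)) `^ alpha.
    rewrite powRM ?powR_ge0 ?expR_ge0// -powRrM; congr (_ * _).
    by rewrite {1}/powR gt_eqF ?expR_gt0// expRK; congr expR; ring.
  apply: ge0_ler_powR;
    rewrite ?nnegrE ?(ltW alpha0) ?mulr_ge0 ?powR_ge0 ?expR_ge0 ?(ltW v0)//.
  have -> : 2 * v k = k%:R `^ gamma * (expR ((1 : R) * k.+1%:R))^-1.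
    by rewrite /v /u; field; rewrite gt_eqF ?expR_gt0.
  rewrite ler_wpM2l ?powR_ge0// -expRN ler_expR lerN2 mul1r.
  by rewrite ler_nat.
have kap_ge : t <= kap.
  have vE : v k = k%:R `^ gamma / (2 * expR 1) / expR ((1 : R) * k%:R).
    rewrite /v /u !mul1r -[k.+1%:R]natr1 expRD.
    by field; rewrite !gt_eqF ?expR_gt0.
  rewrite /kap mulr1 divr1 vE [leRHS]mulrCA.
  have tg : t * (4 * expR 1) <= k%:R `^ gamma.
    have -> : k%:R `^ gamma = t * k%:R `^ (gamma - gamma0).
      by rewrite /t -powRD ?(gt_eqF k0) ?implybT//; congr powR; ring.
    by rewrite ler_wpM2l// ltW.
  apply: (@le_trans _ _ (k%:R `^ gamma / (2 * expR 1) * (1 - 2^-1))).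
    rewrite mulrAC ler_pdivlMr ?mulr_gt0 ?expR_gt0//.
    by move: tg; have := expR_gt0 (1 : R); nra.
  rewrite ler_wpM2l ?divr_ge0 ?mulr_ge0 ?powR_ge0 ?expR_ge0//.
  by rewrite ler_pdivlMr.
have kap_le : kap <= k%:R `^ gamma.
  rewrite /kap mulr1 divr1.
  have NE : (epoch (1 : R) k - (lag K k).*2)%:R <= expR ((1 : R) * k%:R) :> R.
    by rewrite (le_trans _ (epoch_le 1 k))// ler_nat leq_subr.
  apply: (@le_trans _ _ (expR ((1 : R) * k.+1%:R) * v k)).
    rewrite ler_wpM2r ?(ltW v0)// (le_trans NE)// ler_expR !mul1r.
    by rewrite ler_nat.
  rewrite /v mulrCA divff ?gt_eqF ?expR_gt0// mulr1 /u.
  by rewrite ler_piMr ?powR_ge0// invf_le1// ler1n.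
have D0 : 0 <= D by rewrite mulr_ge0 ?powR_ge0 ?(ltW C10).
have holderD (d : R) : 0 <= d -> d <= 2 * v k -> C1 * d `^ alpha <= D.
  move=> d0 dv; rewrite /D ler_wpM2l ?(ltW C10)//; apply: ge0_ler_powR => //.
  - exact: ltW.
  - by rewrite nnegrE mulr_ge0// ltW.
clearbody D.
have kapD : kap * D <= 1.
  apply: le_trans kapDsmall.
  rewrite powRD ?(gt_eqF k0) ?implybT// -mulrA mulrCA.
  rewrite ler_pM ?(le_trans (ltW t0) kap_ge)//.
have Dt : D <= t^-1 / 2.
  rewrite ler_pdivlMl//.
  apply: le_trans Dsmall.
  rewrite powRD ?(gt_eqF k0) ?implybT// -/t [_ * t]mulrC -mulrA mulrCA.
  by rewrite ler_wpM2l// ltW.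
have := main (fun x => rho x - D) (t^-1 / 2) (expR 1 * I k).
move=> /(_ _ _ _ _ _)/le_trans; apply.
- exact: measurable_funB.
- move=> a b x abX /andP[ax xb] ab; apply: mass_ge => //.
    by rewrite (le_trans ax)// ltW.
  move=> y /andP[ay yb].
  have Xx : X x by apply: abX; rewrite /= in_itv/= ax.
  have Xy : X y by apply: abX; rewrite /= in_itv/= ay.
  have xy : `|x - y| <= 2 * v k.
    by rewrite (le_trans _ ab)// ler_norml; apply/andP; split; lra.
  have := holder _ _ Xx Xy; rewrite ler_norml => /andP[_].
  by have := holderD _ (normr_ge0 (x - y)) xy; lra.
- have -> : k%:R `^ (- p) = t^-1 * (k%:R `^ (p - gamma0))^-1.
    by rewrite /t -!powRN -powRD ?(gt_eqF k0) ?implybT//; congr powR; ring.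
  by rewrite ler_wpM2l ?invr_ge0 ?(ltW t0)// lef_pV2 ?posrE ?powR_gt0.
- by rewrite mulr_ge0 ?expR_ge0.
- rewrite EFinM; apply: (@le_trans _ _ ((expR 1)%:E *
    \int[lam]_(x in X) (rho x * expR (- (t * rho x)))%:E)%E); last first.
    by rewrite lee_wpmul2l ?lee_fin ?expR_ge0//; exact: hI.
  have mexp (g : R -> R) : measurable_fun X g ->
      measurable_fun X (fun x => (rho x * expR (- g x))%:E).
    move=> mg; apply/measurable_EFinP; apply: measurable_funM => //.
    by apply: measurableT_comp => //; exact: measurable_funN.
  rewrite -ge0_integralZl//; last 2 first.
  - by apply: mexp; exact: measurable_funM.
  - by move=> x Xx; rewrite lee_fin mulr_ge0 ?expR_ge0 ?rho_ge0.
  apply: ge0_le_integral => //.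
  - by move=> x Xx; rewrite lee_fin mulr_ge0 ?expR_ge0 ?rho_ge0.
  - by apply: mexp; apply: measurable_funM => //; exact: measurable_funB.
  - by apply: measurable_funeM; apply: mexp; exact: measurable_funM.
  - move=> x Xx; rewrite -EFinM lee_fin [leRHS]mulrCA -expRD.
    rewrite ler_wpM2l ?rho_ge0// ler_expR -/kap mulrBr.
    have : t * rho x <= kap * rho x by rewrite ler_wpM2r ?rho_ge0.
    by move: kapD; lra.
rewrite addrA lerD2r lerD2l.
apply: le_trans (pr_low_density t0 (hI k kN)).
apply: pr_le.
- by apply: measurable_lt_cst => //; exact: measurable_funB.
- exact: measurable_lt_cst.
- by move=> x [Xx /= gx]; split=> //=; move: gx Dt; lra.
Unshelve. all: by end_near. Qed.

End upper_bounds.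

(** * Indicators of intervals and Borel measures on the line *)

Section bounded_variation.
Context {R : realType}.

Lemma variation_ge_indicator (p a : R) (s : seq R) : path <%R a s ->
  variation a (last a s) (fun x => (p <= x)%R%:R) s <= 1.
Proof.
move=> as_; rewrite nondecreasing_variation//.
  rewrite lerBlDr; case: (p <= last a s); case: (p <= a);
    by rewrite ?addr0 ?lerDl ?addr_ge0.
move=> x y _ _ xy; have [px|_] := boolP (p <= x); last exact: ler0n.
by rewrite (le_trans px xy).
Qed.

(** The indicator of an interval is a difference of two monotone indicators. *)
Lemma var_indic_le (X : set R) (p q : R) :
  (var X \1_(`[p, q[%classic : set R) <= 2%:E)%E.
Proof.
apply: ge_ereal_sup => _ [a [s [as_ _ ->]]]; rewrite lee_fin.
pose h (c x : R) : R := (c <= x)%R%:R.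
have -> : \1_(`[p, q[%classic : set R) = h p \+ (\- h (Num.max p q)).
  apply/funext => x; rewrite /= indicE /h.
  have -> : (x \in (`[p, q[%classic : set R)) = (p <= x) && (x < q).
    by apply/idP/idP; rewrite inE /= in_itv.
  rewrite ge_max; have [px|xp] := leP p x; have [qx|xq] := leP q x => /=;
    by rewrite ?subrr ?subr0.
apply: (le_trans (variation_le _ _ _ _ _)); rewrite variationN.
have := variation_ge_indicator p as_.
by have := variation_ge_indicator (Num.max p q) as_; rewrite -/(h _); lra.
Qed.

Lemma bv_norm_indic_le (X : set R) (p q : R) :
  (bv_norm X \1_(`[p, q[%classic : set R) <= 3%:E)%E.
Proof.
have -> : (3%:E = 2%:E + 1%:E :> \bar R)%E by rewrite -EFinD; congr EFin; lra.
rewrite /bv_norm leeD ?var_indic_le//; apply: ge_ereal_sup => _ [x _ <-].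
by rewrite lee_fin indicE; case: (_ \in _); rewrite ?normr1 ?normr0.
Qed.

Lemma norm_le_bv_norm (X : set R) (phi : R -> R) x : X x -> is_BV X phi ->
  `|phi x| <= fine (bv_norm X phi).
Proof.
move=> Xx bv.
have var0 : (0 <= var X phi)%E.
  apply: ereal_sup_ubound; exists x, [::].
  split=> //; last by rewrite variation_nil.
  by move=> y; rewrite inE => /eqP ->.
have sup_ge : (`|phi x|%:E <= ereal_sup [set `|phi x|%:E | x in X])%E.
  by apply: ereal_sup_ubound; exists x.
have le : (`|phi x|%:E <= bv_norm X phi)%E.
  by rewrite /bv_norm -[leLHS]add0e leeD.
rewrite -lee_fin fineK// ge0_fin_numE// (le_trans _ le)// lee_fin.
Qed.
End bounded_variation.

Section borel.
Context {R : realType}.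

(** The types R and [measurableTypeR R] have the same measurable sets but are
    different measurable types; measures and integrals are carried from the
    second to the first by the identity. *)
Definition borel_id : measurableTypeR R -> R := idfun.

Lemma measurable_borel_id : measurable_fun setT borel_id.
Proof. exact: (@measurable_id _ _ setT). Qed.

HB.instance Definition _ := @isMeasurableFun.Build _ _ _ _ borel_id
  measurable_borel_id.

Definition borel (mu : probability (measurableTypeR R) R) : probability R R :=
  distribution mu borel_id.

(** Lebesgue measure, as a measure on the measurable type R. *)
Definition leb : {measure set R -> \bar R} :=
  measure_function_pushforward__canonical__measure_function_Measure
    (@lebesgue_measure R) measurable_borel_id.

Lemma integral_borel (mu : probability (measurableTypeR R) R) (D : set R)
    (g : R -> \bar R) : measurable D -> measurable_fun D g ->
  (forall x, D x -> 0 <= g x)%E ->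
  (\int[borel mu]_(x in D) g x = \int[mu]_(x in D) g x)%E.
Proof.
move=> mD mg g0.
have := ge0_integral_pushforward measurable_borel_id mu mD mg.
by move=> ->// x /set_mem; exact: g0.
Qed.

Lemma integral_leb (D : set R) (g : R -> \bar R) :
  measurable D -> measurable_fun D g -> (forall x, D x -> 0 <= g x)%E ->
  (\int[leb]_(x in D) g x = \int[@lebesgue_measure R]_(x in D) g x)%E.
Proof.
move=> mD mg g0.
have := ge0_integral_pushforward measurable_borel_id (@lebesgue_measure R) mD mg.
by move=> ->// x /set_mem; exact: g0.
Qed.

Lemma leb_itv (a b : R) : a <= b -> leb `[a, b[%classic = (b - a)%:E.
Proof.
move=> ab; have := lebesgue_measure_itv `[a, b[ => /=.
rewrite lte_fin /leb /pushforward/= => ->.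
by have [//|ba|->] := ltgtP a b; [rewrite ltNge ab in ba|rewrite subrr].
Qed.
End borel.

(** * Consequences of hyperbolic recurrence *)

Section extension.
Context {R : realType} (X : set R) (f : R -> R).
Hypothesis fX : forall x, X x -> X (f x).

Lemma iter_restrict j x : X x ->
  iter j (f \_ X) x = iter j f x /\ X (iter j f x).
Proof.
move=> Xx; elim: j => [//|j [ih Xj]] /=.
by rewrite ih patchT ?inE//; split => //; exact: fX.
Qed.

Lemma min_return_restrict n x : X x ->
  min_return (f \_ X) n x = min_return f n x.
Proof.
move=> Xx; rewrite /min_return patchT ?inE//.
by apply: eq_bigr => k _; rewrite (iter_restrict k Xx).1.
Qed.
End extension.

Section hyperbolic_recurrent.
Context {R : realType} (X : set R) (f : R -> R)
  (mu : probability (measurableTypeR R) R) (rho : R -> R).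
Hypothesis hyp : hyperbolic_recurrent X f mu rho.

Let nu := borel mu.
(** The extension of f by 0 outside X is measurable on the whole line, and X is
    invariant and of full measure, so nothing is lost. *)
Let F := f \_ X.

Lemma hr_interval : is_interval X. Proof. by case: hyp => -[[]]. Qed.

Lemma hr_measurable : measurable X.
Proof. exact: is_interval_measurable hr_interval. Qed.
Let mX := hr_measurable.

Lemma hr_full : nu X = 1%E. Proof. by case: hyp => -[[]]. Qed.

Lemma hr_stable x : X x -> X (f x).
Proof. by case: hyp => -[_ [fX _ _ _]] _ _ _; exact: fX. Qed.

Lemma hr_measurable_map : measurable_fun setT F.
Proof.
apply: (measurable_restrictT f mX).1.
by case: hyp => -[_ []].
Qed.
Let mF := hr_measurable_map.

Lemma pr_borelE A : measurable A -> mu A = (pr nu A)%:E.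
Proof. exact: (prE nu). Qed.

Lemma restrict_preimage j A :
  X `&` iter j F @^-1` A = X `&` iter j f @^-1` A.
Proof.
by apply/seteqP; split=> x [Xx]; rewrite /preimage/= (iter_restrict hr_stable j Xx).1.
Qed.

Lemma hr_invariant A : measurable A -> pr nu (F @^-1` A) = pr nu A.
Proof.
move=> mA.
have mFA : measurable (F @^-1` A) by rewrite -[X in measurable X]setTI; exact: mF.
rewrite -(pr_full nu mX hr_full mFA) -[RHS](pr_full nu mX hr_full mA).
have -> : X `&` F @^-1` A = X `&` f @^-1` (X `&` A).
  rewrite (restrict_preimage 1); apply/seteqP; split=> x [Xx fx]; split=> //.
    by split=> //; exact: hr_stable.
  by case: fx.
have inv : invariant_on X f mu by case: hyp => -[_ []].
by rewrite /pr; congr fine; apply: inv; [exact: measurableI|move=> x []].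
Qed.

(** The constant 3 bounds the norm of the indicator of an interval: variation 2
    and supremum 1. *)
Lemma hr_mixing : exists C0 c0 : R, [/\ 0 <= C0, 0 < c0 &
  forall (a b : R) (j : nat) (A : set R), measurable A ->
    `|pr nu (`[a, b[ `&` iter j F @^-1` A) - pr nu `[a, b[ * pr nu A| <=
    C0 * expR (- (c0 * j%:R)) * pr nu A].
Proof.
have [C0 [c0 [C00 c00 mix]]] : exp_decay_correlations X f mu by case: hyp.
exists (3 * C0), c0; split=> //; first by rewrite mulr_ge0 ?ltW.
move=> a b j A mA.
set B : set R := `[a, b[%classic.
have mB : measurable B by exact: measurable_itv.
have mjA : measurable (iter j F @^-1` A) by exact: measurable_iter_preimage.
have indicX (E : set R) : measurable E ->
    (\int[mu]_(x in X) (\1_E x)%:E = (pr nu E)%:E)%E.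
  move=> mE; have mI : measurable_fun X (fun x : R => (\1_E x : R)%:E).
    by apply/measurable_EFinP; exact: measurable_funTS.
  rewrite -(integral_borel mu mX mI); last first.
    by move=> x _; rewrite lee_fin indicE ler0n.
  rewrite integral_indic// setIC -(pr_full nu mX hr_full mE).
  by apply: (prE nu); exact: measurableI.
have intA : mu.-integrable X (EFin \o \1_A).
  exact: (@integrableS _ (measurableTypeR R) R mu setT X _ measurableT mX
    (@subsetT _ X) (integrable_indic mu mA)).
have := mix \1_B \1_A j (le_lt_trans (bv_norm_indic_le X a b) (ltry _)) intA.
rewrite !indicX//.
have -> : (\int[mu]_(x in X) (\1_B x * \1_A (iter j f x))%:E =
    (pr nu (B `&` iter j F @^-1` A))%:E)%E.
  rewrite -indicX; last exact: measurableI.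
  apply: eq_integral => x /set_mem Xx; congr EFin.
  by rewrite !indicE in_setI -natrM mulnb -(iter_restrict hr_stable j Xx).1.
have -> : l1_norm X mu \1_A = (pr nu A)%:E.
  rewrite -indicX//; apply: eq_integral => x _; congr EFin.
  by rewrite ger0_norm// indicE ler0n.
rewrite -EFinM -EFinB abse_EFin => /le_trans h; rewrite -lee_fin; apply: h.
rewrite [leRHS]EFinM lee_wpmul2r ?lee_fin ?pr_ge0//.
rewrite -mulrA [3 * _]mulrC [leRHS]EFinM lee_wpmul2l ?bv_norm_indic_le//.
by rewrite lee_fin mulr_ge0 ?expR_ge0 ?ltW.
Qed.

Lemma hr_short_returns : exists beta C : R, [/\ 0 < beta, 0 <= C &
  forall n j : nat, (1 <= n)%N -> (1 <= j)%N ->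
    j%:R <= (ln n%:R : R) ^+ 2 ->
    pr nu (return_set F j (n%:R `^ (- 2^-1))) <= C * n%:R `^ (- beta)].
Proof.
have short : short_return_bound X f mu by case: hyp.
have [||beta0 [C [/andP[b0 b1] C0 h]]] := short 2^-1 (fun n => n%:R `^ (- 2^-1)).
- by [].
- exists 2; first by rewrite ltr1n.
  move=> n n1; rewrite divff; last by rewrite gt_eqF// powR_gt0// ltr0n.
  by rewrite invf_le1// !ler1n.
exists (2^-1 * beta0), C; split; [by rewrite mulr_gt0|exact: ltW|].
move=> n j n1 j1 jn; have := h n j n1 j1 jn.
rewrite -powRrM mulNr => h'.
have mE : measurable (return_set F j (n%:R `^ (- 2^-1))).
  exact: measurable_return_set.
rewrite -(pr_full nu mX hr_full mE) -lee_fin -(prE nu); last exact: measurableI.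
apply: le_trans h'; rewrite le_eqVlt; apply/orP; left; apply/eqP.
congr (mu _); apply/seteqP; split=> x [Xx].
  by rewrite /return_set/= (iter_restrict hr_stable j Xx).1.
by rewrite /return_set/= => h'; split => //=; rewrite (iter_restrict hr_stable j Xx).1.
Qed.

(** A point of period k returns within n^(-1/2) at time k for all n, an event whose
    probability tends to 0 as n grows. *)
Lemma hr_aperiodic k : (0 < k)%N -> nu (return_set F k 0) = 0%E.
Proof.
move=> k0; have mE : measurable (return_set F k 0) by exact: measurable_return_set.
rewrite (prE nu mE); congr EFin; apply/eqP; rewrite eq_le pr_ge0 andbT.
apply/ler_addgt0Pr => e e0; rewrite add0r.
have [beta [C [b0 C0 h]]] := hr_short_returns.
have [N _ hN] : \forall n \near \oo,
    C / e <= n%:R `^ beta /\ k%:R <= ln (1 * n%:R) :> R.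
  near=> n; split; near: n; [exact: near_powR_ge|exact: near_ln_ge].
have [] := hN (maxn N 1) (leq_maxl _ _); set n := maxn N 1; rewrite mul1r => nC nk.
have n1 : (1 <= n)%N by exact: leq_maxr.
have np : 0 < n%:R `^ beta :> R by rewrite powR_gt0// ltr0n.
apply: (@le_trans _ _ (C * n%:R `^ (- beta))); last first.
  by rewrite powRN ler_pdivrMr// mulrC -ler_pdivrMr.
apply: (le_trans _ (h n k n1 k0 _)).
  apply: pr_le => //; first exact: measurable_return_set.
  by move=> x; rewrite /return_set/= => /le_trans; apply; exact: powR_ge0.
have k1 : 1 <= k%:R :> R by rewrite ler1n.
by rewrite (le_trans nk)// expr2 ler_peMl// (le_trans _ nk)// (le_trans ler01).
Unshelve. all: by end_near. Qed.

Lemma hr_measurable_density : measurable_fun X rho.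
Proof. by case: hyp => -[[_ _ []]]. Qed.

Lemma hr_density_ge0 x : X x -> 0 <= rho x.
Proof. by case: hyp => -[[_ _ [_ h _]] _] _ _ _; exact: h. Qed.

Lemma hr_density A : measurable A -> A `<=` X ->
  nu A = (\int[leb]_(x in A) (rho x)%:E)%E.
Proof.
move=> mA AX; rewrite integral_leb//.
- by case: hyp => -[[_ _ [_ _ h]] _] _ _ _; exact: h.
- by apply/measurable_EFinP; apply: measurable_funS hr_measurable_density.
- by move=> x /AX; rewrite lee_fin; exact: hr_density_ge0.
Qed.

Lemma hr_nonempty : X !=set0.
Proof.
apply: contrapT => nX; have := hr_full.
have -> : X = set0 by apply/seteqP; split=> // x Xx; apply: nX; exists x.
by rewrite measure0 => /esym/eqP; rewrite onee_eq0.
Qed.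

Lemma hr_density_le : exists2 M : R, 0 <= M & forall x, X x -> rho x <= M.
Proof.
exists (fine (bv_norm X rho)).
  have [x Xx] := hr_nonempty.
  apply: (le_trans (normr_ge0 (rho x))); apply: norm_le_bv_norm => //.
  by case: hyp.
move=> x Xx; rewrite (le_trans (ler_norm _))//; apply: norm_le_bv_norm => //.
by case: hyp.
Qed.

(** The almost sure statements concern the extension F of the restricted map; their
    events A n are measurable and agree on X with the events P n of f. *)
Lemma full_event (A : nat -> set R) (P : nat -> R -> Prop) :
  (forall n, measurable (A n)) ->
  (forall n x, X x -> A n x <-> P n x) ->
  (exists Z : set R, [/\ measurable Z, nu Z = 0%E &
    forall x, X x -> ~ Z x -> \forall n \near \oo, A n x]) ->
  mu [set x | X x /\ \forall n \near \oo, P n x] = 1%E.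
Proof.
move=> mA AP [Z [mZ Z0 hZ]].
have -> : [set x | X x /\ \forall n \near \oo, P n x] =
    X `&` [set x | \forall n \near \oo, A n x].
  apply/seteqP; split=> x [Xx [N _ h]]; split=> //; exists N => // n Nn.
    by apply/AP => //; exact: h.
  by apply/AP => //; exact: h.
have mE : measurable [set x | \forall n \near \oo, A n x].
  exact: measurable_eventually.
have mXE := measurableI _ _ mX mE.
rewrite (pr_borelE mXE); congr EFin; apply/eqP; rewrite eq_le pr_le1//=.
have <- : pr nu X = 1 by rewrite /pr hr_full.
have -> : pr nu (X `&` [set x | \forall n \near \oo, A n x]) =
    pr nu (X `&` [set x | \forall n \near \oo, A n x]) + pr nu Z.
  by rewrite [pr nu Z]/pr Z0 addr0.
apply: (le_trans _ (prU_le nu mXE mZ)); apply: pr_le => //.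
  exact: measurableU.
move=> x Xx; have [Zx|nZx] := pselect (Z x); [by right|left].
by split=> //; exact: hZ.
Qed.
End hyperbolic_recurrent.

(** * Almost sure bounds *)

Theorem theorem2p8 (R : realType) (X : set R) (f : R -> R)
    (mu : probability (measurableTypeR R) R) (rho : R -> R)
    (hyp : hyperbolic_recurrent X f mu rho) :
  (forall r : nat -> R,
     ((forall x, X x -> 0 < rho x) /\
      (exists c : R, 1 < 2 * c * inf [set rho x | x in X] /\
         forall n : nat, (2 <= n)%N -> c * ln (ln n%:R) / n%:R < r n))
     \/
     (holder_on X rho /\
      (exists gamma0 gamma : R,
         [/\ (forall eps : R, 0 < eps ->
                (\sum_(1 <= k <oo) \int[@lebesgue_measure R]_(x in X)
                   (rho x * expR (- (eps * (k%:R `^ gamma0) * rho x)))%:E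
                 < +oo)%E),
             gamma0 < gamma &
             forall n : nat, (1 <= n)%N ->
               ((ln n%:R) `^ gamma) / (2 * n%:R) < r n])) ->
     mu [set x | X x /\ \forall n \near \oo, min_return f n x < r n] = 1%E)
  /\
  (forall r : nat -> R,
     (* Monotonicity is needed: the implication is false for arbitrary sequences. *)
     (forall m n : nat, (1 <= m)%N -> (m <= n)%N -> r n <= r m) ->
     (\sum_(1 <= n <oo) \int[mu]_(x in X) mu (X `&` ball x (r n)) < +oo)%E ->
     mu [set x | X x /\ \forall n \near \oo, r n < min_return f n x] = 1%E).
Proof.
have itvX := hr_interval hyp.
have mX := hr_measurable hyp.
have X1 := hr_full hyp.
have mF := hr_measurable_map hyp.
have invF := hr_invariant hyp.
have [C0 [c0 [C00 c00 mixF]]] := hr_mixing hyp.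
have [beta [C [beta0 Cge0 shortF]]] := hr_short_returns hyp.
have mrho := hr_measurable_density hyp.
have rho0 := hr_density_ge0 hyp.
have [M M0 rhoM] := hr_density_le hyp.
have dens := hr_density hyp.
have fX := hr_stable hyp.
have minE := min_return_restrict fX.
split=> r.
- move=> hr; apply: (full_event hyp
    (A := fun n => [set x | min_return (f \_ X) n x < r n])).
  + move=> n; rewrite -[X in measurable X]setTI.
    exact: measurable_lt_cst (measurable_min_return n mF).
  + by move=> n x Xx; rewrite /= minE.
  case: hr => [[rho_gt0 [c [hc hr]]]|[[C1 [alpha [C10 /andP[alpha0 _] holder]]]
      [gamma0 [gamma [hsum gg hr]]]]].
  + have rho_inf x : X x -> inf [set rho x | x in X] <= rho x.
      move=> Xx; apply: ge_inf; last by exists x.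
      by exists 0 => _ [y Xy <-]; exact: rho0.
    have inf0 : 0 <= inf [set rho x | x in X].
      have [x Xx] := hr_nonempty hyp.
      apply: lb_le_inf; first by exists (rho x), x.
      by move=> _ [y Xy <-]; exact: rho0.
    apply: (upper_of_pos_density mF invF C00 c00 mixF beta0 Cge0 shortF itvX X1
      leb_itv mrho rho0 M0 rhoM dens _ rho_inf hc hr).
    rewrite lt_neqAle inf0 andbT eq_sym; apply/negP => /eqP inf00.
    by move: hc; rewrite inf00 mulr0 ltr10.
  + pose e k := (\int[@lebesgue_measure R]_(x in X)
      (rho x * expR (- (1 * (k%:R `^ gamma0) * rho x)))%:E)%E.
    have e0 k : (0 <= e k)%E.
      apply: integral_ge0 => x Xx.
      by rewrite lee_fin mulr_ge0 ?expR_ge0 ?rho0.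
    have [sume eE] := bounded_sums_fine e0 (hsum 1 ltr01).
    apply: (upper_of_holder_density mF invF C00 c00 mixF beta0 Cge0 shortF itvX
      X1 leb_itv mrho rho0 M0 rhoM dens C10 alpha0 holder gg sume _ _ hr).
    * by move=> k; exact: fine_ge0.
    * move=> k k1; rewrite -(eE k k1) integral_leb//.
      - by rewrite /e; under eq_integral do rewrite -[k%:R `^ gamma0]mul1r.
      - apply/measurable_EFinP; apply: measurable_funM => //.
        apply: measurableT_comp => //; apply: measurable_funN.
        exact: measurable_funM.
      - by move=> x Xx; rewrite lee_fin mulr_ge0 ?expR_ge0 ?rho0.
- move=> rmono hsum; apply: (full_event hyp
    (A := fun n => [set x | r n < min_return (f \_ X) n x])).
  + move=> n.
    have -> : [set x | r n < min_return (f \_ X) n x] =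
        [set: R] `&` [set x | - min_return (f \_ X) n x < - r n].
      by apply/seteqP; split=> x; rewrite /= ltrN2 ?setTI//; case.
    apply: measurable_lt_cst => //; apply: measurable_funN.
    exact: measurable_min_return.
  + by move=> n x Xx; rewrite /= minE.
  pose e n := (\int[mu]_(x in X) mu (X `&` ball x (r n)))%E.
  have e0 n : (0 <= e n)%E by apply: integral_ge0 => x _; exact: measure_ge0.
  have [sume eE] := bounded_sums_fine e0 hsum.
  apply: (eventually_lt_min_return mF mX X1 _ mixF rmono _ _ _ sume).
  + by move=> j; rewrite mulr_ge0 ?expR_ge0.
  + by move=> n; exact: fine_ge0.
  + move=> n n1; rewrite -(eE n n1) integral_borel//.
    by apply: measurable_funTS; exact: measurable_pr_ball.
  + exact: bounded_sums_expRN.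
  + exact: (hr_aperiodic hyp).
Qed.
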